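(* For arbitrary real-time $\mathrm{SC\text{-}OCA}(n)$s, and for arbitrary real-time $\mathrm{MC\text{-}OCA}(\log n)$s, accepting bounded languages, each of the following problems is undecidable: finiteness, infiniteness, universality, inclusion, equivalence, regularity, and context-freedom of the accepted language(s).
   Context: A language $L$ over $\{a_1,\dots,a_k\}$ is bounded if $L\subseteq a_1^*a_2^*\cdots a_k^*$. A CA is $\langle S,F,A,B,\#,b_l,b_r,\delta\rangle$ with communication functions $b_l,b_r:S\to B\cup\{\bot\}$ ($\bot$: nothing sent) and local transition $\delta:(B\cup\{\#,\bot\})\times S\times(B\cup\{\#,\bot\})\to S$; cells $1..|w|$ start with input letters and update synchronously by $c_{t+1}(i)=\delta(b_r(c_t(i-1)),c_t(i),b_l(c_t(i+1)))$, outer cells receiving $\#$ once at the first step. Acceptance: the leftmost cell enters an accepting state; real time: accepted inputs accepted within $|w|$ steps. OCA: $b_r\equiv\bot$, leftmost cell gets no boundary symbol. $\mathrm{com}(i,t)$: number of steps $j<t$ with $b_r(c_j(i))\ne\bot$ or $b_l(c_j(i+1))\ne\bot$; $\mathrm{mcom}(w)=\max_i\mathrm{com}(i,t(|w|))$, $\mathrm{scom}(w)=\sum_{i=1}^{|w|-1}\mathrm{com}(i,t(|w|))$. $\mathrm{SC\text{-}OCA}(n)$: OCAs such that every accepted $w$ is accepted with $\mathrm{scom}(w)\le g(|w|)$ for some $g\in O(n)$; $\mathrm{MC\text{-}OCA}(\log n)$: OCAs such that every accepted $w$ is accepted with $\mathrm{mcom}(w)\le g(|w|)$ for some $g\in O(\log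 n)$. *)

(* Defs.v *)
From HB Require Import structures.
From mathcomp Require Import all_boot.
Unset Printing Implicit Defensive.

(*  states S = 'I_nS, input alphabet {a_1..a_k} = 'I_k (a_1 < ... < a_k),    *)
(*  embedded into S by the injective map inp (A is a subset of S),           *)
(*  accepting states F, communication alphabet B = 'I_nB.                    *)
(*  b_l : S -> B + {bot}  (None = bot);  b_r is identically bot (OCA).        *)
(*  delta : S x (B + {#, bot}) -> S, where the received symbol is encoded as  *)
(*    None = bot, Some None = #, Some (Some b) = b.                          *)
(*  (The left argument of the CA transition is always bot in an OCA, since   *)
(*   b_r = bot and the leftmost cell gets no boundary symbol, so it is       *)
(*   omitted.)                                                               *)
Record OCA := MkOCA {
  nS : nat; k : nat; nB : nat;
  inp : {ffun 'I_k -> 'I_nS};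
  accF : {set 'I_nS};
  bl : {ffun 'I_nS -> option 'I_nB};
  delta : {ffun ('I_nS * option (option 'I_nB))%type -> 'I_nS} }.

Definition OCA_sig := {p : nat * nat * nat &
  ({ffun 'I_p.1.2 -> 'I_p.1.1} * {set 'I_p.1.1} * {ffun 'I_p.1.1 -> option 'I_p.2}
   * {ffun ('I_p.1.1 * option (option 'I_p.2))%type -> 'I_p.1.1})%type}.

Definition OCA_to_sig (M : OCA) : OCA_sig :=
  existT _ (nS M, k M, nB M) (inp M, accF M, bl M, delta M).
Definition OCA_of_sig (s : OCA_sig) : OCA :=
  let: existT p d := s in @MkOCA p.1.1 p.1.2 p.2 d.1.1.1 d.1.1.2 d.1.2 d.2.
Lemma OCA_to_sigK : cancel OCA_to_sig OCA_of_sig. Proof. by case. Qed.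
HB.instance Definition _ := Countable.copy OCA (can_type OCA_to_sigK).

Definition sent (M : OCA) (s : 'I_(nS M)) : option (option 'I_(nB M)) :=
  if bl M s is Some b then Some (Some b) else None.

(* one synchronous step at time t; the rightmost cell receives # only at t = 0 *)
Definition step (M : OCA) (t : nat) (c : seq 'I_(nS M)) : seq 'I_(nS M) :=
  let msgs := rcons (map (@sent M) (behead c)) (if t == 0 then Some None else None) in
  map (fun p => delta M p) (zip c msgs).

Definition config (M : OCA) (w : seq 'I_(k M)) (t : nat) : seq 'I_(nS M) :=
  iteri t (step M) (map (inp M) w).

Definition acc_at (M : OCA) (w : seq 'I_(k M)) (t : nat) : bool :=
  if config M w t is s :: _ then s \in accF M else false.

Definition acceptsW (M : OCA) (w : seq 'I_(k M)) : Prop := exists t, acc_at M w t.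

Definition realtime (M : OCA) : Prop :=
  forall w, acceptsW M w -> exists2 t, t <= size w & acc_at M w t.

(* communication over the boundary between cells i and i+1 (0-indexed) at step j *)
Definition sends (M : OCA) (w : seq 'I_(k M)) (j i : nat) : bool :=
  if drop i.+1 (config M w j) is s :: _ then bl M s != None else false.

Definition com (M : OCA) (w : seq 'I_(k M)) (i t : nat) : nat :=
  count (fun j => sends M w j i) (iota 0 t).

(* real time: t(|w|) = |w| *)
Definition scom (M : OCA) (w : seq 'I_(k M)) : nat :=
  \sum_(i < (size w).-1) com M w i (size w).
Definition mcom (M : OCA) (w : seq 'I_(k M)) : nat :=
  \max_(i < (size w).-1) com M w i (size w).

Definition bigO (f g : nat -> nat) : Prop :=
  exists c N, forall n, N <= n -> f n <= c * g n.

Definition SC_OCA_lin (M : OCA) : Prop :=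
  exists g, bigO g (fun n => n) /\ forall w, acceptsW M w -> scom M w <= g (size w).
Definition MC_OCA_log (M : OCA) : Prop :=
  exists g, bigO g (trunc_log 2) /\ forall w, acceptsW M w -> mcom M w <= g (size w).

Definition lang (M : OCA) (u : seq nat) : Prop :=
  exists w : seq 'I_(k M), u = map (@nat_of_ord _) w /\ acceptsW M w.

(* bounded: L(M) is a subset of a_1^* a_2^* ... a_k^* *)
Definition bounded (M : OCA) : Prop := forall u, lang M u -> sorted leq u.

Definition valid (M : OCA) : Prop := injective (inp M).

Definition dom (cls : OCA -> Prop) (M : OCA) : Prop :=
  [/\ valid M, realtime M, cls M & bounded M].

Definition finite_lang (M : OCA) : Prop :=
  exists s : seq (seq nat), forall u, lang M u -> u \in s.

(* universality for bounded languages: L(M) = a_1^*...a_k^* (non-empty words) *)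
Definition universal (M : OCA) : Prop :=
  forall u, lang M u <-> [/\ u != [::], all (fun a => a < k M) u & sorted leq u].

Definition included (M1 M2 : OCA) : Prop := forall u, lang M1 u -> lang M2 u.
Definition equivalent (M1 M2 : OCA) : Prop := forall u, lang M1 u <-> lang M2 u.

Definition regular (M : OCA) : Prop :=
  exists (Q : finType) (q0 : Q) (F : {set Q}) (d : Q -> 'I_(k M) -> Q),
    forall w : seq 'I_(k M), lang M (map (@nat_of_ord _) w) <-> foldl d q0 w \in F.

Definition derive1 (N T : eqType) (R : seq (N * seq (N + T))) (u v : seq (N + T)) : Prop :=
  exists x y A r, (A, r) \in R /\ u = x ++ inl A :: y /\ v = x ++ r ++ y.
Arguments derive1 {N T}.
Inductive derives (N T : eqType) (R : seq (N * seq (N + T))) : seq (N + T) -> seq (N + T) -> Prop :=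
| derives_refl u : derives N T R u u
| derives_step u v w : derive1 (N:=N) (T:=T) R u v -> derives N T R v w -> derives N T R u w.


Arguments derives {N T}.

Definition context_free (M : OCA) : Prop :=
  exists (N : finType) (S : N) (R : seq (N * seq (N + 'I_(k M)))),
    forall w : seq 'I_(k M),
      lang M (map (@nat_of_ord _) w) <-> derives R [:: inl S] (map inr w).

Inductive instr := INC of nat | DEC of nat & nat.
Definition mstep (P : seq instr) (s : nat * (nat -> nat)) : nat * (nat -> nat) :=
  let: (pc, r) := s in
  match drop pc P with
  | INC i :: _ => (pc.+1, fun j => if j == i then (r j).+1 else r j)
  | DEC i l :: _ =>
      if r i is n.+1 then (pc.+1, fun j => if j == i then n else r j) else (l, r)
  | [::] => s
  end.

Definition computes (P : seq instr) (x y : nat) : Prop :=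
  exists n, let: (pc, r) := iter n (mstep P) (0, fun j => if j == 0 then x else 0) in
            size P <= pc /\ r 0 = y.

Definition decidable_on (T : countType) (D P : T -> Prop) : Prop :=
  exists Pr : seq instr, forall x, D x ->
    (P x -> computes Pr (pickle x) 1) /\ (~ P x -> computes Pr (pickle x) 0).
Arguments decidable_on {T}.
Definition undecidable_on (T : countType) (D P : T -> Prop) : Prop :=
  ~ decidable_on D P.

Arguments undecidable_on {T}.

Definition all_problems_undecidable (cls : OCA -> Prop) : Prop :=
  let D := dom cls in
  let D2 := fun p : OCA * OCA => [/\ D p.1, D p.2 & k p.1 = k p.2] in
  undecidable_on D finite_lang /\
  undecidable_on D (fun M => ~ finite_lang M) /\
  undecidable_on D universal /\
  undecidable_on D2 (fun p => included p.1 p.2) /\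
  undecidable_on D2 (fun p => equivalent p.1 p.2) /\
  undecidable_on D regular /\
  undecidable_on D context_free.

(* Main.v *)
(* A counter machine is simulated inside words a^x b^y. At time 0 the border between
   the a's and the b's emits a signal that moves left with speed 1/2 and carries the
   program counter; it is followed by one mark per register, the delay of a mark being
   the content of the register. Each cell makes one step of the machine by delaying
   marks by one step more or less, and a register is zero iff its mark arrives
   together with the signal; a cell sends boundedly many messages. The signal of the
   right boundary, of speed 1, catches up with the machine after exactly y cells, so it
   can check that x = y and that the machine is at a marked instruction after x - 1
   steps.
   The automaton accepts either the words passing this check, or their complement in
   a^* b^*.

   The machine numbered e starts by loading e into register 0. If one of the problems
   were decidable, a machine could compute the code of its own automaton, call the
   decision procedure, and then either never visit the marked instruction (the
   language is empty, or universal for the complement) or visit it after longer and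
   longer delays. In the latter case the language is infinite, and not context-free
   because replacing a lowest subtree with a long yield by a shortest one shortens a
   long word of a context-free language by a bounded amount. *)

Require Import Defs.
From HB Require Import structures.
From mathcomp Require Import all_boot.
From mathcomp Require Import zify.
From Stdlib Require Import Classical FunctionalExtensionality.

Set Implicit Arguments.
Unset Strict Implicit.

(** * Gaps between the lengths of the words of a context-free language *)

Section Grammar.
Variables (N : finType) (T : eqType) (R : seq (N * seq (N + T))).

Lemma derives_trans u v w : derives R u v -> derives R v w -> derives R u w.
Proof. by elim=> // u1 v1 w1 s _ IH /IH; apply: derives_step. Qed.

Lemma derives_ctx x y u v : derives R u v -> derives R (x ++ u ++ y) (x ++ v ++ y).
Proof.
elim=> [{}u|u1 v1 w1 [x1 [y1 [A [r [Ar [-> ->]]]]]] _ IH]; first exact: derives_refl.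
apply: derives_step IH; exists (x ++ x1), (y1 ++ y), A, r; split=> //.
by rewrite -!catA.
Qed.

Lemma derives_cat u1 u2 v1 v2 :
  derives R u1 v1 -> derives R u2 v2 -> derives R (u1 ++ u2) (v1 ++ v2).
Proof.
move=> /(derives_ctx [::] u2) /= H1 /(derives_ctx v1 [::]); rewrite !cats0.
exact: derives_trans.
Qed.

(** Bounding the number of steps gives an induction that survives splitting a derivation: both
    halves inherit the bound. *)
Fixpoint derives_upto n (u w : seq (N + T)) : Prop :=
  u = w \/ if n is n'.+1 then exists2 v, derive1 R u v & derives_upto n' v w else False.

Lemma derives_uptoP u w : derives R u w -> exists n, derives_upto n u w.
Proof.
elim=> [{}u|u1 v1 w1 s _ [n IH]]; first by exists 0; left.
by exists n.+1; right; exists v1.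
Qed.

Lemma derives_uptoS n u w : derives_upto n u w -> derives_upto n.+1 u w.
Proof.
by elim: n u => [|n IH] u /= [->|]; [left| |left|case=> v uv /IH vw; right; exists v].
Qed.

Lemma cat_eq_cat_cons (S : Type) (u1 u2 x y : seq S) a :
  u1 ++ u2 = x ++ a :: y ->
  (exists2 z, u1 = x ++ a :: z & y = z ++ u2) \/
  (exists2 z, x = u1 ++ z & u2 = z ++ a :: y).
Proof.
elim: u1 x => [|b u1 IH] [|c x] /=.
- by move=> ->; right; exists [::].
- by move=> ->; right; exists (c :: x).
- by case=> -> <-; left; exists u1.
case=> -> /IH[[z -> ->]|[z -> ->]]; first by left; exists z.
by right; exists z.
Qed.

(** A rule rewrites a single nonterminal, which lies in one of the two factors, so the steps sort
    themselves into two independent derivations. *)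
Lemma derives_upto_cat n u1 u2 w : derives_upto n (u1 ++ u2) w ->
  exists w1 w2, [/\ w = w1 ++ w2, derives_upto n u1 w1 & derives_upto n u2 w2].
Proof.
elim: n u1 u2 => [|n IH] u1 u2 /= [<-|]; try by exists u1, u2; split=> //; left.
case=> v [x [y [A [r [Ar [e ->]]]]]].
case: (cat_eq_cat_cons e) => [[z -> ->]|[z -> ->]].
  rewrite !catA -(catA x) => /IH[w1 [w2 [-> H1 /derives_uptoS H2]]].
  exists w1, w2; split=> //; right.
  by exists (x ++ r ++ z); [exists x, z, A, r | rewrite catA in H1 *].
rewrite -catA => /IH[w1 [w2 [-> /derives_uptoS H1 H2]]].
exists w1, w2; split=> //; right.
by exists (z ++ r ++ y); first exists z, y, A, r.
Qed.

(** [N] is finite: pick one word for each productive nonterminal and take the maximal length. *)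
Lemma short_words : exists c, forall A w, derives R [:: inl A] (map inr w) ->
  exists2 w', derives R [:: inl A] (map inr w') & size w' <= c.
Proof.
suff [c H] : exists c, forall A, A \in enum N -> forall w,
    derives R [:: inl A] (map inr w) ->
    exists2 w', derives R [:: inl A] (map inr w') & size w' <= c.
  by exists c => A; apply: H; rewrite mem_enum.
elim: (enum N) => [|A s [c IH]]; first by exists 0.
have [[w0 H0]|no] := classic (exists w, derives R [:: inl A] (map inr w)).
  exists (maxn (size w0) c) => B; rewrite inE => /predU1P[->|/IH{}IH] w.
    by exists w0; rewrite // leq_maxl.
  by case/IH=> w' ? ?; exists w'; rewrite // leq_max orbC; apply/orP; left.
exists c => B; rewrite inE => /predU1P[->|/IH //] w H.
by case: no; exists w.
Qed.

(* A subtree whose yield exceeds [c] while its children's do not has bounded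
   yield; replace it by a shortest word of its root nonterminal. *)
Lemma cfg_length_gap : exists c D, forall u w, derives R u (map inr w) ->
  size w <= c * size u \/
  exists2 w', derives R u (map inr w') & size w' < size w <= size w' + D.
Proof.
have [c0 short] := short_words; pose c := maxn c0 1.
pose B := \max_(p <- R) size p.2.
(* [c] bounds the replacement words and is at least 1, so that a single terminal never counts as
   long; [B] bounds the right-hand sides of the rules. *)
exists c, (c * B) => u w /derives_uptoP[n].
elim: n u w => [|n IHn] u w H.
  left; case: H => // ->; rewrite size_map; apply: leq_pmull.
  by rewrite leq_max orbT.
elim: u w H => [|s u IHu] w H.
  case: H => [|[v [[|? ?] [y [A [r [_ []]]]]]]] //.
  by case: w => //; left.
have {H} [w1 [w2 [ew H1 H2]]] := @derives_upto_cat _ [:: s] u _ H.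
have [v1 [v2 [e {}ew e1 e2]]] : exists v1 v2,
  [/\ w = v1 ++ v2, True, w1 = map inr v1 & w2 = map inr v2].
  exists (take (size w1) w), (drop (size w1) w).
  rewrite cat_take_drop; split=> //; rewrite ?map_take ?map_drop ew.
    by rewrite take_size_cat.
  by rewrite drop_size_cat.
have derE u' w' m : derives_upto m u' w' -> derives R u' w'.
  elim: m u' => [|m IH] u' /= [->|] //; try exact: derives_refl.
  by case=> v uv /IH; apply: derives_step.
subst w w1 w2; rewrite size_cat /=.
have [small2|[v2' d2 ?]] := IHu _ H2; last first.
  right; exists (v1 ++ v2'); last by rewrite size_cat; lia.
  by rewrite map_cat; apply: (@derives_cat [:: s]); [exact: derE H1|].
have {H2} d2 := derE _ _ _ H2.
have [small1|big1] := leqP (size v1) c; first by left; rewrite mulnS leq_add.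
right.
suff [v1' d1 ?] : exists2 v1', derives R [:: s] (map inr v1') &
    size v1' < size v1 <= size v1' + c * B.
  exists (v1' ++ v2); last by rewrite size_cat; lia.
  by rewrite map_cat; apply: (@derives_cat [:: s]).
case: H1 => [e1|[v [x [y [A [r [Ar [e1 ->]]]]]]]].
  have : size (map (@inr N T) v1) = 1 by rewrite -e1.
  rewrite size_map => e2; move: big1; rewrite e2 ltnNge leq_max orbC //.
case: x e1 => [|? [] //] /= [-> <-]; rewrite cats0 => Hr.
have dA w' : derives R r (map inr w') -> derives R [:: inl A] (map inr w').
  apply: derives_step; exists [::], [::], A, r; split=> //=; split=> //.
  by rewrite cats0.
(* Either the yield is at most [c * size r] and the whole subtree is exchanged for a short one, or
   the shortening already happens below this node. *)
have [le|[v1' d1 ?]] := IHn _ _ Hr; last by exists v1' => //; exact: dA.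
have [v1' d1 le1] := short _ _ (dA _ (derE _ _ _ Hr)).
exists v1' => //; apply/andP; split.
  by apply: leq_ltn_trans big1; rewrite leq_max le1.
apply: leq_trans (leq_addl _ _); apply: (leq_trans le).
rewrite leq_mul2l; apply/orP; right.
by rewrite /B (big_rem (A, r)) //= leq_maxl.
Qed.
End Grammar.

(** * Primitive recursive functions on counter machines *)

Notation state := (nat -> nat).

Definition upd (s : state) i x : state := fun j => if j == i then x else s j.

Ltac upd_ext :=
  intros; apply: functional_extensionality => ?; rewrite /upd /=;
  repeat (case: eqP => ?; subst); try lia; try reflexivity; try congruence.

Inductive cmd := Skip | Inc of nat | Seq of cmd & cmd | Loop of nat & cmd.

(* Register 1 is never written: being 0, it provides unconditional jumps. *)
Inductive exec : cmd -> state -> state -> Prop :=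
| exec_skip s : exec Skip s s
| exec_inc i s : i != 1 -> exec (Inc i) s (upd s i (s i).+1)
| exec_seq c1 c2 s1 s2 s3 :
    exec c1 s1 s2 -> exec c2 s2 s3 -> exec (Seq c1 c2) s1 s3
| exec_loop0 i c s : s i = 0 -> exec (Loop i c) s s
| exec_loopS i c s n s1 s2 : s i = n.+1 -> exec c (upd s i n) s1 ->
    exec (Loop i c) s1 s2 -> exec (Loop i c) s s2.

Fixpoint csize c : nat :=
  match c with
  | Skip => 0
  | Inc _ => 1
  | Seq c1 c2 => csize c1 + csize c2
  | Loop _ c => (csize c).+2
  end.

Fixpoint asm a c : seq instr :=
  match c with
  | Skip => [::]
  | Inc i => [:: INC i]
  | Seq c1 c2 => asm a c1 ++ asm (a + csize c1) c2
  | Loop i c => DEC i (a + (csize c).+2) :: asm a.+1 c ++ [:: DEC 1 a]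
  end.

Lemma size_asm a c : size (asm a c) = csize c.
Proof.
elim: c a => //= [c1 IH1 c2 IH2|i c IH] a; first by rewrite size_cat IH1 IH2.
by rewrite size_cat IH addn1.
Qed.

#[local] Arguments mstep : simpl never.

Lemma mstep_inc P pre i post r : P = pre ++ INC i :: post ->
  mstep P (size pre, r) = ((size pre).+1, upd r i (r i).+1).
Proof. by move=> ->; rewrite /mstep drop_size_cat //; congr pair; upd_ext. Qed.

Lemma mstep_dec0 P pre i l post r : P = pre ++ DEC i l :: post -> r i = 0 ->
  mstep P (size pre, r) = (l, r).
Proof. by move=> -> e; rewrite /mstep drop_size_cat //= e. Qed.

Lemma mstep_decS P pre i l post r n : P = pre ++ DEC i l :: post -> r i = n.+1 ->
  mstep P (size pre, r) = ((size pre).+1, upd r i n).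
Proof. by move=> -> e; rewrite /mstep drop_size_cat //= e; congr pair; upd_ext. Qed.

Lemma exec_zero c s s' : exec c s s' -> s 1 = 0 -> s' 1 = 0.
Proof.
elim=> //.
- by move=> i {}s i1 s0; rewrite /upd eq_sym (negPf i1).
- by move=> c1 c2 s1 s2 s3 _ IH1 _ IH2 /IH1/IH2.
move=> i {}c {}s n s1 s2 e _ IH1 _ IH2 s0; apply/IH2/IH1.
by rewrite /upd; case: eqP => // i1; rewrite -i1 s0 in e.
Qed.

Lemma asm_correct c s s' : exec c s s' -> s 1 = 0 ->
  forall P pre post, P = pre ++ asm (size pre) c ++ post ->
  exists n, iter n (mstep P) (size pre, s) = (size pre + csize c, s').
Proof.
elim=> [{}s|i {}s _|c1 c2 s1 s2 s3 H1 IH1 H2 IH2|i {}c {}s e|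
        i {}c {}s n s1 s2 e H1 IH1 H2 IH2] s0 P pre post eP.
- by exists 0; rewrite addn0.
- by exists 1; rewrite /= (mstep_inc _ eP) addn1.
- have [|n1 e1] := IH1 s0 P pre (asm (size pre + csize c1) c2 ++ post).
    by rewrite eP /= -catA.
  have [|n2 e2] := IH2 (exec_zero H1 s0) P (pre ++ asm (size pre) c1) post.
    by rewrite eP /= size_cat size_asm !catA.
  exists (n2 + n1); rewrite iterD e1.
  by move: e2; rewrite size_cat size_asm => ->; rewrite /= addnA.
- by exists 1; rewrite /= (mstep_dec0 eP).
have s0' : upd s i n 1 = 0.
  by rewrite /upd; case: eqP => // i1; rewrite -i1 s0 in e.
have s10 := exec_zero H1 s0'.
have [|n1 e1] := IH1 s0' P (rcons pre (DEC i (size pre + (csize c).+2)))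
    (DEC 1 (size pre) :: post).
  by rewrite eP size_rcons /= cat_rcons /= -catA.
have [n2 e2] := IH2 s10 P pre post eP.
exists (n2 + (1 + (n1 + 1))); rewrite iterD (iterD 1) (iterD n1) /=.
rewrite (mstep_decS (n := n) eP) //; move: e1; rewrite size_rcons => ->.
have -> : (size pre).+1 + csize c =
  size (pre ++ DEC i (size pre + (csize c).+2) :: asm (size pre).+1 c).
  by rewrite size_cat /= size_asm; lia.
by rewrite (@mstep_dec0 _ _ 1 (size pre) post) //= eP /= -!catA.
Qed.

Definition clear i := Loop i Skip.
Definition mv i j := Loop i (Inc j).

Lemma exec_clear i s : exec (clear i) s (upd s i 0).
Proof.
move e : (s i) => n; elim: n s e => [|n IH] s e.
  by rewrite (_ : upd s i 0 = s); [apply: exec_loop0|upd_ext].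
apply: exec_loopS e (exec_skip _) _.
have := IH (upd s i n); rewrite {1}/upd eqxx => /(_ erefl).
by congr exec; upd_ext.
Qed.

Lemma exec_mv i j s : i != j -> j != 1 ->
  exec (mv i j) s (upd (upd s i 0) j (s i + s j)).
Proof.
move=> ij j1; move e : (s i) => n; elim: n s e => [|n IH] s e.
  rewrite (_ : upd _ _ _ = s); first exact: exec_loop0.
  by move: ij; upd_ext.
apply: exec_loopS e (exec_inc _ j1) _.
have := IH (upd (upd s i n) j (upd s i n j).+1).
rewrite {1}/upd (negPf ij) {1}/upd eqxx => /(_ erefl).
by congr exec; move: ij; upd_ext.
Qed.

(** * Compilation of primitive recursive terms *)

Definition scons (x : nat) (v : state) : state := fun j => if j is j'.+1 then v j' else x.

(** De Bruijn terms: the body of [Rec] sees the accumulator as variable 0 and the index as variable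
    1, and [Let2] provides composition. *)
Inductive exp :=
| Var of nat | Zero | Succ of exp | Rec of exp & exp & exp | Let2 of exp & exp & exp.

Fixpoint eval e (v : state) : nat :=
  match e with
  | Var i => v i
  | Zero => 0
  | Succ e => (eval e v).+1
  | Rec n z s => iteri (eval n v) (fun i a => eval s (scons a (scons i v))) (eval z v)
  | Let2 f g e => eval e (scons (eval f v) (scons (eval g v) v))
  end.

(** [rho] places the variables in registers below [b]; the result goes to [b], and the registers
    from [b] on are expected to be zero. A variable is copied by draining its register into [b] and
    [b.+1] and refilling it from [b.+1]. In [Rec], [b] holds the accumulator, [b.+1] the remaining
    rounds and [b.+2] the index. *)
Fixpoint cexp (rho : state) b e : cmd :=
  match e with
  | Var i => Seq (Loop (rho i) (Seq (Inc b) (Inc b.+1))) (mv b.+1 (rho i))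
  | Zero => Skip
  | Succ e => Seq (cexp rho b e) (Inc b)
  | Rec n z s =>
      Seq (cexp rho b z) (Seq (cexp rho b.+1 n)
     (Seq (Loop b.+1 (Seq (cexp (scons b (scons b.+2 rho)) b.+3 s)
                     (Seq (clear b) (Seq (mv b.+3 b) (Inc b.+2)))))
          (clear b.+2)))
  | Let2 f g e =>
      Seq (cexp rho b f) (Seq (cexp rho b.+1 g)
     (Seq (cexp (scons b (scons b.+1 rho)) b.+2 e)
     (Seq (clear b) (Seq (clear b.+1) (mv b.+2 b)))))
  end.

Lemma exec_copy r b s : r < b -> 1 < b ->
  exec (Loop r (Seq (Inc b) (Inc b.+1))) s
       (upd (upd (upd s r 0) b (s b + s r)) b.+1 (s b.+1 + s r)).
Proof.
move=> rb b1; move e : (s r) => n; elim: n s e => [|n IH] s e.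
  rewrite (_ : upd _ _ _ = s); first exact: exec_loop0.
  by upd_ext.
apply: exec_loopS e _ _.
  by apply: exec_seq; apply: exec_inc; lia.
set s' := upd _ _ _; have := IH s'.
have -> : s' r = n by rewrite /s' /upd; do ?case: eqP; lia.
move=> /(_ erefl); congr exec; rewrite /s'.
upd_ext.
Qed.

Lemma exec_cexp e rho b s : 1 < b -> (forall j, rho j < b) ->
  (forall j, rho j != 1) -> (forall j, b <= j -> s j = 0) ->
  exec (cexp rho b e) s (upd s b (eval e (s \o rho))).
Proof.
elim: e rho b s => [i||e IH|n IHn z IHz e IHe|f IHf g IHg e IHe] rho b s b1 rb r1 s0 /=.
- apply: exec_seq; first exact: exec_copy.
  set s' := upd _ b.+1 _.
  rewrite (_ : upd s b _ = upd (upd s' b.+1 0) (rho i) (s' b.+1 + s' (rho i))).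
    by apply: exec_mv => //; have := rb i; lia.
  have := rb i; have := s0 b; have := s0 b.+1; rewrite /s'.
  by move=> /(_ (leqnSn _)) ? /(_ (leqnn _)) ? ?; upd_ext.
- rewrite (_ : upd s b 0 = s); first exact: exec_skip.
  by have := s0 b (leqnn _) => ?; upd_ext.
- apply: exec_seq; first exact: IH.
  set s' := upd s b _.
  rewrite (_ : upd s b _ = upd s' b (s' b).+1); first by apply: exec_inc; lia.
  by rewrite /s'; upd_ext.
- set x := eval z _; set m := eval n _.
  apply: exec_seq; first exact: IHz.
  have rb' j : rho j < b.+1 by rewrite ltnS ltnW.
  apply: exec_seq.
    apply: IHn => //; first by lia.
    by move=> j bj; rewrite /upd; case: eqP; [lia|rewrite s0 //; lia].
  rewrite (_ : eval n _ = m); last first.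
    congr eval; apply: functional_extensionality => j; rewrite /upd /=.
    by case: eqP => // rj; have := rb j; lia.
  pose F := fun i a => eval e (scons a (scons i (s \o rho))).
  pose S i k := upd (upd (upd s b (iteri i F x)) b.+1 k) b.+2 i.
  apply: (@exec_seq _ _ _ (S m 0)); last first.
    rewrite (_ : upd s b _ = upd (S m 0) b.+2 0); first exact: exec_clear.
    rewrite /S; have := s0 b.+1; have := s0 b.+2 => s1 s2.
    by upd_ext.
  rewrite (_ : upd _ _ _ = S 0 m); last first.
    by rewrite /S; have := s0 b.+2 => s1; upd_ext; rewrite s1; lia.
  suff loop k i : exec (Loop b.+1 (Seq (cexp (scons b (scons b.+2 rho)) b.+3 e)
      (Seq (clear b) (Seq (mv b.+3 b) (Inc b.+2))))) (S i k) (S (k + i) 0).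
    by have := loop m 0; rewrite addn0.
  elim: k i => [|k IH] i.
    by apply: exec_loop0; rewrite /S /upd; do ?case: eqP; lia.
  apply: (@exec_loopS _ _ _ k); first by rewrite /S /upd; do ?case: eqP; lia.
    have eS : upd (S i k.+1) b.+1 k = S i k by rewrite /S; upd_ext.
    rewrite eS; apply: exec_seq.
      apply: IHe; [by lia|move=> [|[|j]] /=; try lia..|].
      + by have := rb j; lia.
      + by have := r1 j.
      by move=> j bj; rewrite /S /upd; do ?case: eqP; try lia; rewrite s0 //; lia.
    rewrite (_ : eval e _ = F i (iteri i F x)); last first.
      congr eval; apply: functional_extensionality => -[|[|j]] /=;
        try (have := rb j); rewrite /S /upd; do ?case: eqP; lia.
    apply: exec_seq; first exact: exec_clear.
    apply: exec_seq; first by apply: exec_mv; lia.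
    by apply: exec_inc; lia.
  rewrite addSnnS; move: (IH i.+1).
  congr exec; have s3 := s0 b.+3; rewrite /S.
  by upd_ext; rewrite ?s3 /=; lia.
set x := eval f _; set y := eval g _.
have rb' j : rho j < b.+1 by rewrite ltnS ltnW.
apply: exec_seq; first exact: IHf.
apply: exec_seq.
  apply: IHg => //; first by lia.
  by move=> j bj; rewrite /upd; case: eqP; [lia|rewrite s0 //; lia].
rewrite (_ : eval g _ = y); last first.
  congr eval; apply: functional_extensionality => j; rewrite /upd /=.
  by case: eqP => // rj; have := rb j; lia.
apply: exec_seq.
  apply: IHe; [by lia|move=> [|[|j]] /=; try lia..|].
  + by have := rb j; lia.
  + by have := r1 j.
  by move=> j bj; rewrite /upd; do ?case: eqP; try lia; rewrite s0 //; lia.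
rewrite (_ : eval e _ = eval e (scons x (scons y (s \o rho)))); last first.
  congr eval; apply: functional_extensionality => -[|[|j]] /=;
    try (have := rb j); rewrite /upd; do ?case: eqP; lia.
apply: exec_seq; first exact: exec_clear.
apply: exec_seq; first exact: exec_clear.
set w := eval e _; set s' := upd _ b.+1 0.
rewrite (_ : upd s b w = upd (upd s' b.+2 0) b (s' b.+2 + s' b)).
  by apply: exec_mv; lia.
have s1 := s0 b.+1; have s2 := s0 b.+2; rewrite /s'.
by upd_ext; rewrite ?s1 ?s2; lia.
Qed.

(** * Closure properties of primitive recursive functions *)

Definition pr (f : state -> nat) := exists e, forall v, eval e v = f v.

Lemma eq_pr f g : f =1 g -> pr f -> pr g.
Proof. by move=> fg [e He]; exists e => v; rewrite He fg. Qed.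

Lemma pr_var i : pr (fun v => v i).
Proof. by exists (Var i). Qed.

Lemma pr_succ f : pr f -> pr (fun v => (f v).+1).
Proof. by case=> e He; exists (Succ e) => v /=; rewrite He. Qed.

Lemma pr_const n : pr (fun _ => n).
Proof. by elim: n => [|n IH]; [exists Zero|apply: pr_succ]. Qed.

Lemma pr_iteri f g (h : nat -> nat -> state -> nat) : pr f -> pr g ->
  pr (fun v => h (v 1) (v 0) (fun j => v j.+2)) ->
  pr (fun v => iteri (f v) (fun i a => h i a v) (g v)).
Proof.
move=> [ef Hf] [eg Hg] [eh Hh]; exists (Rec ef eg eh) => v /=.
by rewrite Hf Hg; apply: eq_iteri => i a; rewrite Hh.
Qed.

Lemma pr_comp2 F f g : pr (fun v => F (v 0) (v 1)) -> pr f -> pr g ->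
  pr (fun v => F (f v) (g v)).
Proof.
move=> [eF HF] [ef Hf] [eg Hg]; exists (Let2 ef eg eF) => v /=.
by rewrite HF Hf Hg.
Qed.

Lemma pr_comp1 F f : pr (fun v => F (v 0)) -> pr f -> pr (fun v => F (f v)).
Proof. by move=> HF Hf; apply: (@pr_comp2 (fun x _ => F x) f f). Qed.

Lemma pr_add f g : pr f -> pr g -> pr (fun v => f v + g v).
Proof.
move=> Hf Hg; apply: (@eq_pr (fun v => iteri (f v) (fun _ a => a.+1) (g v))).
  by move=> v; elim: (f v) => //= n ->.
by apply: pr_iteri => //; apply/pr_succ/pr_var.
Qed.

Lemma pr_pred f : pr f -> pr (fun v => (f v).-1).
Proof.
move=> Hf; apply: (@eq_pr (fun v => iteri (f v) (fun i _ => i) 0)).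
  by move=> v; elim: (f v) => //= n ->.
by apply: pr_iteri => //; [exact: pr_const|exact: pr_var].
Qed.

Lemma pr_sub f g : pr f -> pr g -> pr (fun v => f v - g v).
Proof.
move=> Hf Hg; apply: (@eq_pr (fun v => iteri (g v) (fun _ a => a.-1) (f v))).
  by move=> v; elim: (g v) => /= [|n ->]; rewrite ?subn0 // subnS.
by apply: pr_iteri => //; apply/pr_pred/pr_var.
Qed.

Lemma pr_mul f g : pr f -> pr g -> pr (fun v => f v * g v).
Proof.
move=> Hf Hg; apply: (@pr_comp2 muln) => //.
apply: (@eq_pr (fun v => iteri (v 0) (fun _ a => v 1 + a) 0)).
  by move=> v; elim: (v 0) => //= n ->.
apply: pr_iteri; [exact: pr_var|exact: pr_const|].
by apply: pr_add; exact: pr_var.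
Qed.

Lemma pr_exp f g : pr f -> pr g -> pr (fun v => f v ^ g v).
Proof.
move=> Hf Hg; apply: (@pr_comp2 expn) => //.
apply: (@eq_pr (fun v => iteri (v 1) (fun _ a => v 0 * a) 1)).
  by move=> v; elim: (v 1) => //= n ->; rewrite expnS.
apply: pr_iteri; [exact: pr_var|exact: pr_const|].
by apply: pr_mul; exact: pr_var.
Qed.

Lemma pr_if (b : state -> bool) f g : pr (fun v => b v) -> pr f -> pr g ->
  pr (fun v => if b v then f v else g v).
Proof.
move=> Hb Hf Hg.
apply: (@eq_pr (fun v => b v * f v + (1 - b v) * g v)).
  by move=> v; case: (b v); lia.
by apply: pr_add; apply: pr_mul => //; apply: pr_sub => //; exact: pr_const.
Qed.

Lemma pr_leq f g : pr f -> pr g -> pr (fun v => f v <= g v).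
Proof.
move=> Hf Hg; apply: (@eq_pr (fun v => 1 - (f v - g v))); first by move=> v; lia.
by apply: pr_sub; [exact: pr_const|exact: pr_sub].
Qed.

Lemma pr_andb (a b : state -> bool) : pr (fun v => a v) -> pr (fun v => b v) ->
  pr (fun v => a v && b v).
Proof.
move=> Ha Hb; apply: (@eq_pr (fun v => a v * b v)); last exact: pr_mul.
by move=> v; case: (a v); case: (b v).
Qed.

Lemma pr_orb (a b : state -> bool) : pr (fun v => a v) -> pr (fun v => b v) ->
  pr (fun v => a v || b v).
Proof.
move=> Ha Hb; apply: (@eq_pr (fun v => if a v then 1 else b v)).
  by move=> v; case: (a v).
by apply: pr_if => //; exact: pr_const.
Qed.

Lemma pr_negb (b : state -> bool) : pr (fun v => b v) -> pr (fun v => ~~ b v).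
Proof.
move=> Hb; apply: (@eq_pr (fun v => 1 - b v)); first by move=> v; case: (b v).
by apply: pr_sub => //; exact: pr_const.
Qed.

Lemma pr_eqn f g : pr f -> pr g -> pr (fun v => f v == g v).
Proof.
move=> Hf Hg; apply: (@eq_pr (fun v => (f v <= g v) && (g v <= f v))).
  by move=> v; rewrite -eqn_leq.
by apply: pr_andb; apply: pr_leq.
Qed.

Lemma sum_iteri n (F : nat -> nat) : \sum_(j < n) F j = iteri n (fun j a => a + F j) 0.
Proof. by elim: n => [|n IH]; rewrite ?big_ord0 ?big_ord_recr //= IH. Qed.

Lemma pr_sum f (h : nat -> state -> nat) : pr f ->
  pr (fun v => h (v 1) (fun j => v j.+2)) -> pr (fun v => \sum_(j < f v) h j v).
Proof.
move=> Hf Hh.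
apply: (@eq_pr (fun v => iteri (f v) (fun j a => a + h j v) 0)).
  by move=> v; rewrite (sum_iteri _ (fun j => h j v)).
by apply: pr_iteri => //; [exact: pr_const|apply: pr_add; [exact: pr_var|]].
Qed.

(** Counting the indices below a threshold recovers the threshold; this turns bounded search into a
    sum. *)
Lemma sum_ltn n q : \sum_(j < n) (j < q) = minn n q.
Proof.
elim: n => [|n IH]; first by rewrite big_ord0 min0n.
by rewrite big_ord_recr /= IH; lia.
Qed.

Lemma pr_div f g : pr f -> pr g -> pr (fun v => f v %/ g v).
Proof.
move=> Hf Hg; apply: (@pr_comp2 divn) => //.
apply: (@eq_pr (fun v => if v 1 == 0 then 0 else
                         \sum_(j < v 0) (j.+1 * v 1 <= v 0))).
  move=> v; case: eqP => [->|/eqP]; first by rewrite divn0.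
  rewrite -lt0n => d0; transitivity (\sum_(j < v 0) (j < v 0 %/ v 1)).
    by apply: eq_bigr => j _; rewrite -leq_divRL.
  by rewrite sum_ltn; apply/minn_idPr/leq_div.
apply: pr_if; [|exact: pr_const|].
  by apply: pr_eqn; [exact: pr_var|exact: pr_const].
apply: (@pr_sum _ (fun j v => j.+1 * v 1 <= v 0 : nat)); first exact: pr_var.
by apply: pr_leq; [apply: pr_mul; [apply: pr_succ|]|]; exact: pr_var.
Qed.

Lemma pr_mod f g : pr f -> pr g -> pr (fun v => f v %% g v).
Proof.
move=> Hf Hg; apply: (@eq_pr (fun v => f v - f v %/ g v * g v)).
  by move=> v; rewrite {1}(divn_eq (f v) (g v)) addKn.
by apply: pr_sub => //; apply: pr_mul => //; apply: pr_div.
Qed.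

Lemma pr_odd f : pr f -> pr (fun v => odd (f v)).
Proof.
move=> Hf; apply: (@eq_pr (fun v => f v %% 2)); first by move=> v; rewrite modn2.
by apply: pr_mod => //; exact: pr_const.
Qed.

(* [CodeSeq.code (x :: s) = npair x (CodeSeq.code s)]. *)
Definition npair x y := 2 ^ x * y.*2.+1.
(** The 2-adic valuation, as a bounded sum to make it visibly primitive recursive. *)
Definition nfst n := \sum_(j < n) (n %% 2 ^ j.+1 == 0).
Definition nsnd n := n %/ 2 ^ nfst n %/ 2.

Lemma nfstE n : nfst n = logn 2 n.
Proof.
case: n => [|n]; first by rewrite /nfst big_ord0.
transitivity (\sum_(j < n.+1) (j < logn 2 n.+1)).
  by apply: eq_bigr => j _; rewrite -/(dvdn _ _) pfactor_dvdn.
by rewrite sum_ltn; apply/minn_idPr/ltnW; rewrite ltn_logl.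
Qed.

Lemma nfst_pair x y : nfst (npair x y) = x.
Proof.
rewrite nfstE /npair lognM ?expn_gt0 // pfactorK // lognE /=.
by rewrite dvdn2 /= odd_double addn0.
Qed.

Lemma nsnd_pair x y : nsnd (npair x y) = y.
Proof. by rewrite /nsnd nfst_pair /npair mulKn ?expn_gt0 // divn2 /= uphalf_double. Qed.

Lemma nfst_leq n : nfst n <= n.
Proof.
rewrite nfstE; case: n => // n; apply/ltnW; exact: ltn_logl.
Qed.

Lemma nsnd_leq n : nsnd n <= n.-1.
Proof.
rewrite /nsnd; apply: (@leq_trans (n %/ 2)); first by rewrite leq_div2r // leq_div.
by lia.
Qed.

Lemma npair_gt0 x y : 0 < npair x y.
Proof. by rewrite /npair muln_gt0 expn_gt0. Qed.

Lemma pr_npair f g : pr f -> pr g -> pr (fun v => npair (f v) (g v)).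
Proof.
move=> Hf Hg.
apply: (@eq_pr (fun v => 2 ^ f v * (g v + g v).+1)).
  by move=> v; rewrite /npair addnn.
by apply: pr_mul; [apply: pr_exp => //; exact: pr_const|apply/pr_succ/pr_add].
Qed.

Lemma pr_nfst f : pr f -> pr (fun v => nfst (f v)).
Proof.
apply: pr_comp1; apply: (@pr_sum _ (fun j v => v 0 %% 2 ^ j.+1 == 0 : nat)).
  exact: pr_var.
apply: pr_eqn; last exact: pr_const.
apply: pr_mod; first exact: pr_var.
by apply: pr_exp; [exact: pr_const|apply/pr_succ/pr_var].
Qed.

Lemma pr_nsnd f : pr f -> pr (fun v => nsnd (f v)).
Proof.
move=> Hf; apply: pr_div; last exact: pr_const.
by apply: pr_div => //; apply: pr_exp; [exact: pr_const|exact: pr_nfst].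
Qed.

Definition nnth c n := nfst (iteri n (fun _ a => nsnd a) c).

Lemma nnth_code s n : nnth (CodeSeq.code s) n = nth 0 s n.
Proof.
have tl t : nsnd (CodeSeq.code t) = CodeSeq.code (behead t).
  by case: t => [|x t]; [rewrite /nsnd div0n | apply: nsnd_pair].
rewrite /nnth; have -> : iteri n (fun _ => nsnd) (CodeSeq.code s) = CodeSeq.code (drop n s).
  by elim: n => [|n IH]; rewrite ?drop0 //= IH tl -drop1 drop_drop add1n.
rewrite -[n in RHS]addn0 -nth_drop; case: (drop n s) => [|x t]; last exact: nfst_pair.
by rewrite nfstE.
Qed.

Lemma pr_nnth f g : pr f -> pr g -> pr (fun v => nnth (f v) (g v)).
Proof.
move=> Hf Hg; apply: (@pr_comp2 nnth) => //; apply: pr_nfst.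
apply: (@pr_iteri _ _ (fun _ a _ => nsnd a)); try exact: pr_var.
exact/pr_nsnd/pr_var.
Qed.

Lemma pr_code (h : nat -> nat -> nat) f g : pr (fun v => h (v 0) (v 1)) ->
  pr f -> pr g -> pr (fun v => CodeSeq.code [seq h i (g v) | i <- iota 0 (f v)]).
Proof.
move=> Hh Hf Hg.
apply: (@pr_comp2 (fun n e => CodeSeq.code [seq h i e | i <- iota 0 n])) => //.
apply: (@eq_pr (fun v => iteri (v 0) (fun j a => npair (h (v 0 - j.+1) (v 1)) a) 0)).
  move=> v; set n := v 0.
  suff H k : k <= n -> iteri k (fun j a => npair (h (n - j.+1) (v 1)) a) 0 =
      CodeSeq.code [seq h i (v 1) | i <- iota (n - k) k].
    by rewrite (H _ (leqnn _)) subnn.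
  elim: k => // k IH kn; rewrite /= IH; last exact: ltnW.
  by have -> : n - k = (n - k.+1).+1 by lia.
apply: (@pr_iteri _ _ (fun j a v => npair (h (v 0 - j.+1) (v 1)) a));
  [exact: pr_var|exact: pr_const|].
apply: pr_npair; last exact: pr_var.
apply: (pr_comp2 Hh); last exact: pr_var.
by apply: pr_sub; [|apply: pr_succ]; exact: pr_var.
Qed.

Ltac pr_step := cbv beta; match goal with
  | H : pr ?f |- pr ?f => exact H
  | |- pr (fun _ => ?n) => exact (pr_const n)
  | |- pr (fun v => v ?i) => exact (pr_var i)
  | |- pr (fun v => nat_of_bool (@?a v && @?b v)) => apply (@pr_andb a b)
  | |- pr (fun v => nat_of_bool (@?a v || @?b v)) => apply (@pr_orb a b)
  | |- pr (fun v => nat_of_bool (~~ (@?a v))) => apply (@pr_negb a)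
  | |- pr (fun v => nat_of_bool (@?a v == @?b v)) => apply (@pr_eqn a b)
  | |- pr (fun v => nat_of_bool (@?a v <= @?b v)) => apply (@pr_leq a b)
  | |- pr (fun v => nat_of_bool (odd (@?a v))) => apply (@pr_odd a)
  | |- pr (fun v => if _ then _ else _) => apply: pr_if
  | |- pr (fun v => (@?f v).+1) => apply (@pr_succ f)
  | |- pr (fun v => (@?f v).-1) => apply (@pr_pred f)
  | |- pr (fun v => @?f v + @?g v) => apply (@pr_add f g)
  | |- pr (fun v => @?f v - @?g v) => apply (@pr_sub f g)
  | |- pr (fun v => @?f v * @?g v) => apply (@pr_mul f g)
  | |- pr (fun v => @?f v ^ @?g v) => apply (@pr_exp f g)
  | |- pr (fun v => @?f v %/ @?g v) => apply (@pr_div f g)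
  | |- pr (fun v => @?f v %% @?g v) => apply (@pr_mod f g)
  | |- pr (fun v => npair (@?f v) (@?g v)) => apply (@pr_npair f g)
  | |- pr (fun v => nfst (@?f v)) => apply (@pr_nfst f)
  | |- pr (fun v => nsnd (@?f v)) => apply (@pr_nsnd f)
  | |- pr (fun v => nnth (@?f v) (@?g v)) => apply (@pr_nnth f g)
  end.
Ltac pr_tac := repeat pr_step.

(** * Sets of registers as binary masks *)

Definition bit z i := odd (z %/ 2 ^ i).
(** For 0/1-valued [f] this is the mask of a set; other values are allowed so that masks can be
    added termwise. *)
Definition msum m (f : nat -> nat) := \sum_(i < m) f i * 2 ^ i.

Lemma msum_add m f g : msum m f + msum m g = msum m (fun i => f i + g i).
Proof. by rewrite /msum -big_split; apply: eq_bigr => i _; rewrite mulnDl. Qed.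

Lemma eq_msum m f g : (forall i, i < m -> f i = g i) -> msum m f = msum m g.
Proof. by move=> fg; apply: eq_bigr => i _; rewrite fg. Qed.

Lemma msum1 m (b : bool) i : i < m ->
  msum m (fun j => b && (j == i)) = if b then 2 ^ i else 0.
Proof.
move=> im; rewrite /msum (bigD1 (Ordinal im)) //= eqxx andbT big1; last first.
  by move=> j; rewrite -val_eqE /= => /negPf ->; rewrite andbF.
by case: b; rewrite addn0 ?mul1n.
Qed.

Lemma msum0 m : msum m (fun _ => 0) = 0.
Proof. by rewrite /msum big1. Qed.

Lemma msumT m : msum m (fun _ => 1) = 2 ^ m - 1.
Proof.
elim: m => [|m]; first by rewrite /msum big_ord0.
by rewrite /msum big_ord_recr /= => ->; rewrite expnS; have := expn_gt0 2 m; lia.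
Qed.

Lemma msum_lt m (f : nat -> bool) : msum m f < 2 ^ m.
Proof.
elim: m => [|m]; first by rewrite /msum big_ord0.
by rewrite /msum big_ord_recr /= expnS; case: (f m) => /=; lia.
Qed.

Lemma bit_msum m (f : nat -> bool) i : i < m -> bit (msum m f) i = f i.
Proof.
elim: m => // m IH; rewrite ltnS leq_eqVlt /bit /msum big_ord_recr /= => /predU1P[->|im].
  rewrite addnC divnMDl ?expn_gt0 // divn_small ?addn0 ?oddb //.
  exact: msum_lt.
have -> : 2 ^ m = 2 ^ (m - i) * 2 ^ i by rewrite -expnD subnK // ltnW.
rewrite mulnA addnC divnMDl ?expn_gt0 // oddD.
rewrite [in odd (_ * _)]oddM oddX subn_eq0 leqNgt im /= andbF /=.
exact: IH.
Qed.

(** * The simulated counter machine *)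

(* [e = npair q c], where [c] lists the core program, [0] meaning "stay",
   [npair i 0] meaning [INC i] and [npair i l.+1] meaning [DEC i l]; the core
   runs at address [e], after [e] instructions that load [e] into register 0.
   The instruction at address [e + q] is the marked one. *)
Definition fetch e pc := if pc < e then 1 else nnth (nsnd e) (pc - e).

Definition istep e (s : nat * state) : nat * state :=
  let: (pc, r) := s in let x := fetch e pc in let i := nfst x in
  if x == 0 then s else
  if nsnd x == 0 then (pc.+1, upd r i (r i).+1) else
  if r i == 0 then (e + (nsnd x).-1, r) else (pc.+1, upd r i (r i).-1).

Definition irun e n := iter n (istep e) (0, fun=> 0).
Notation pc_at e n := (irun e n).1.
Notation reg_at e n := (irun e n).2.

(* [z] is the set of zero registers; an action is [0], [2i+1] (increment [i])
   or [2i+2] (decrement [i]). *)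
Definition next_pc e pc z := let x := fetch e pc in
  if x == 0 then pc else
  if (nsnd x != 0) && bit z (nfst x) then e + (nsnd x).-1 else pc.+1.
Definition action e pc z := let x := fetch e pc in
  if x == 0 then 0 else
  if nsnd x == 0 then (nfst x).*2.+1 else
  if bit z (nfst x) then 0 else (nfst x).*2.+2.

Definition zeros e n := msum e.+1 (fun i => reg_at e n i == 0).
Definition action_at e n := if n is n'.+1 then action e (pc_at e n') (zeros e n') else 0.

Lemma nnth_leq c n : nnth c n <= c - n.
Proof.
apply: leq_trans (nfst_leq _) _; elim: n => [|n IH] /=; first by rewrite subn0.
by apply: leq_trans (nsnd_leq _) _; lia.
Qed.

(** Unpairing never increases a number. Hence masks of [e.+1] bits cover all registers in use, and
    finitely many cell states suffice. *)
Lemma fetch_leq e pc : nfst (fetch e pc) <= e /\ nsnd (fetch e pc) <= e.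
Proof.
rewrite /fetch; case: ltnP => _.
  by rewrite -[1](erefl (npair 0 0)) nfst_pair nsnd_pair.
have le : nnth (nsnd e) (pc - e) <= e.
  by have := nnth_leq (nsnd e) (pc - e); have := nsnd_leq e; lia.
split; apply: leq_trans le; [exact: nfst_leq|].
by have := nsnd_leq (nnth (nsnd e) (pc - e)); lia.
Qed.

Lemma fetch_small e pc : fetch e pc != 0 -> pc < e.*2.
Proof.
rewrite /fetch; case: ltnP => [?|?]; first by lia.
by have := nnth_leq (nsnd e) (pc - e); have := nsnd_leq e; lia.
Qed.

Lemma pc_at_leq e n : pc_at e n <= e.*2.
Proof.
elim: n => //= n; rewrite -/(irun e n); case: (irun e n) => pc r /= IH.
have [_ le] := fetch_leq e pc; have := @fetch_small e pc.
by case: eqP => //= _ /(_ isT) lt; do 2?case: ifP => _ //=; lia.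
Qed.

Lemma action_leq e pc z : action e pc z <= e.*2.+2.
Proof.
by have [le _] := fetch_leq e pc; rewrite /action; do ?case: ifP => _; lia.
Qed.

Lemma pc_atS e n : pc_at e n.+1 = next_pc e (pc_at e n) (zeros e n).
Proof.
rewrite /next_pc /zeros /= -/(irun e n); case: (irun e n) => pc r /=.
have [le _] := fetch_leq e pc; rewrite bit_msum //.
by do ?case: eqP.
Qed.

Lemma reg_atS e n i : reg_at e n.+1 i =
  if action_at e n.+1 == i.*2.+1 then (reg_at e n i).+1 else
  if action_at e n.+1 == i.*2.+2 then (reg_at e n i).-1 else reg_at e n i.
Proof.
rewrite /= /action /zeros -/(irun e n); case: (irun e n) => pc r /=.
have [le _] := fetch_leq e pc; rewrite bit_msum //.
case: eqP => //= _; rewrite /upd; set x := nfst _; case: eqP => _ /=.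
  by have [->|ne] := eqVneq i x; [rewrite eqxx|do 2?[case: eqP; first by lia]].
case: eqP => //= _; have [->|ne] := eqVneq i x; last by do 2?[case: eqP; first by lia].
by rewrite eqxx; case: eqP => //; lia.
Qed.

(** The mark of a register being decremented thus arrives after the program mark, late enough to be
    advanced. *)
Lemma action_at_dec e n i : action_at e n.+1 = i.*2.+2 -> 0 < reg_at e n i.
Proof.
rewrite /= /action /zeros; case: (irun e n) => pc r /=.
have [le _] := fetch_leq e pc; rewrite bit_msum //.
case: eqP => //= _; case: eqP => _ /=; first by lia.
by case: eqP => //= r0 e1; have <- : nfst (fetch e pc) = i by [lia]; lia.
Qed.

(** * The cellular automaton *)

(* Tags: 1 letter b, 2 letter a, 3 and 4 the boundary signal has just arrived
   (3: together with the marked program counter), otherwise dead.  [ac] is the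
   action in force, [h] is 0 or one plus the program counter to be sent next,
   [p1] and [p2] are the register marks to be sent in one and two steps, [msg] is
   the message being sent. *)
Definition cell tag ac h p1 p2 msg :=
  npair tag (npair ac (npair h (npair p1 (npair p2 msg)))).
Definition c_tag s := nfst s.
Definition c_ac s := nfst (nsnd s).
Definition c_h s := nfst (nsnd (nsnd s)).
Definition c_p1 s := nfst (nsnd (nsnd (nsnd s))).
Definition c_p2 s := nfst (nsnd (nsnd (nsnd (nsnd s)))).
Definition c_msg s := nsnd (nsnd (nsnd (nsnd (nsnd s)))).

Lemma cellE tag ac h p1 p2 msg :
  (c_tag (cell tag ac h p1 p2 msg) = tag) * (c_ac (cell tag ac h p1 p2 msg) = ac) *
  (c_h (cell tag ac h p1 p2 msg) = h) * (c_p1 (cell tag ac h p1 p2 msg) = p1) *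
  (c_p2 (cell tag ac h p1 p2 msg) = p2) * (c_msg (cell tag ac h p1 p2 msg) = msg).
Proof.
rewrite /c_tag /c_ac /c_h /c_p1 /c_p2 /c_msg /cell.
by rewrite !(nsnd_pair, nfst_pair).
Qed.

Lemma npair_leq x y x' y' : x <= x' -> y <= y' -> npair x y <= npair x' y'.
Proof. by move=> xx yy; rewrite /npair leq_mul ?leq_exp2l //; lia. Qed.

Definition bound e := 2 ^ e.+3.
Definition maxcell e := let w := bound e in cell 4 w w w w (3 + npair w w).

(** The offset 3 keeps these messages apart from the messages 1 to 3; empty marks become 0, so that
    nothing is sent and no communication is counted. *)
Definition marks h z := if (h == 0) && (z == 0) then 0 else 3 + npair h z.

Lemma cell_leq e tag ac h p1 p2 h' z (w := bound e) : tag <= 4 -> ac <= w ->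
  h <= w -> p1 <= w -> p2 <= w -> h' <= w -> z <= w ->
  cell tag ac h p1 p2 (marks h' z) <= maxcell e.
Proof.
move=> *; do 5 ?[apply: npair_leq => //]; rewrite /marks; case: ifP => // _.
by rewrite leq_add2l npair_leq.
Qed.

Lemma cell_leq3 e tag h p1 m : tag <= 4 -> m <= 3 -> h <= bound e -> p1 <= bound e ->
  cell tag 0 h p1 0 m <= maxcell e.
Proof.
move=> *; do 5 ?[apply: npair_leq => //].
by apply: leq_trans (leq_addr _ _).
Qed.

(* Received symbols: 0 nothing, 1 boundary, [m.+1] message [m].  Messages: 1 from
   a b at time 0, 2 and 3 boundary signal coming from an a resp. b,
   [3 + npair o z] the register marks [z] and, if [o = pc.+1], the program mark. *)
Definition sstep e s (m : nat) :=
  if c_tag s == 2 then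
    if (m == 1) || ((m == 3) || (m == 4)) then
      cell (if c_h s == (e + nfst e).+1 then 3 else 4) 0 0 0 0 2
    else if m == 2 then cell 2 0 1 (2 ^ e.+1 - 1) 0 0
    else
      let o := nfst (m - 4) in let z := nsnd (m - 4) in
      let ac := if o == 0 then c_ac s else action e o.-1 z in
      let h := if o == 0 then 0 else (next_pc e o.-1 z).+1 in
      let i := ac.-1 %/ 2 in
      let b := (ac != 0) && bit z i in
      cell 2 ac h (c_p2 s + z - if b then 2 ^ i else 0) (if b && odd ac then 2 ^ i else 0)
        (marks (c_h s) (c_p1 s + if b && ~~ odd ac then 2 ^ i else 0))
  else if c_tag s == 1 then
    if (m == 1) || (m == 4) then cell 4 0 0 0 0 3
    else if m == 3 then cell 0 0 0 0 0 0 else cell 1 0 0 0 0 0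
  else cell 0 0 0 0 0 0.

Definition cstep e s m := let x := sstep e s m in if x <= maxcell e then x else 0.
Definition init (a : nat) := if a == 0 then cell 2 0 0 0 0 0 else cell 1 0 0 0 0 1.

Definition emit s := if c_msg s == 0 then 0 else (c_msg s).+1.

(** Information flows only leftwards, so a cell is determined by its letter and the suffix to its
    right. The empty suffix delivers the boundary symbol, coded 1, at time 0 only. *)
Fixpoint recv e (w : seq nat) : nat -> nat :=
  if w is a :: w' then fun t => emit (iteri t (fun j s => cstep e s (recv e w' j)) (init a))
  else fun t => t == 0.
Definition traj e a w t := iteri t (fun j s => cstep e s (recv e w j)) (init a).
Arguments traj : simpl never.

Lemma recv_cons e a w t : recv e (a :: w) t = emit (traj e a w t).
Proof. by []. Qed.

Lemma trajS e a w t : traj e a w t.+1 = cstep e (traj e a w t) (recv e w t).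
Proof. by []. Qed.

Lemma cell0E : (c_tag 0 = 0) * (c_ac 0 = 0) * (c_h 0 = 0) * (c_p1 0 = 0) *
  (c_p2 0 = 0) * (c_msg 0 = 0).
Proof.
have n0 : nsnd 0 = 0 by rewrite /nsnd div0n.
by rewrite /c_tag /c_ac /c_h /c_p1 /c_p2 /c_msg !n0 nfstE.
Qed.

Definition front s := (c_tag s == 3) || (c_tag s == 4).

(** Ties tags and messages to the letter of the cell: message 2 can only come from an [a], message 3
    only from a [b]. *)
Definition cell_inv (a s : nat) :=
  [|| [&& c_tag s == 2, a == 0 & (c_msg s == 0) || (3 < c_msg s)],
      [&& c_tag s == 1, a == 1 & c_msg s <= 1],
      front s && ((a == 0) && (c_msg s == 2) || (a == 1) && (c_msg s == 3)) |
      (c_tag s == 0) && (c_msg s == 0)].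

Lemma marksE h z : (marks h z == 0) || (3 < marks h z).
Proof. by rewrite /marks; case: ifP => //; have := npair_gt0 h z; lia. Qed.

Lemma cstep_inv e a s m : cell_inv a s -> cell_inv a (cstep e s m).
Proof.
rewrite /cstep; case: ifP => _; last by rewrite /cell_inv !cell0E !orbT.
rewrite /sstep /cell_inv /front.
have [->|ne2] := eqVneq (c_tag s) 2.
  rewrite /= !orbF => /andP[/eqP-> _]; case: ifP => _.
    by case: ifP => _; rewrite !cellE.
  by case: ifP => _; rewrite !cellE //= marksE.
have [->|ne1] := eqVneq (c_tag s) 1; last by rewrite !cellE.
by rewrite /= orbF => /andP[/eqP -> _]; do ?case: ifP => _; rewrite !cellE.
Qed.

Lemma traj_inv e a w t : a < 2 -> cell_inv a (traj e a w t).
Proof.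
move=> a2; elim: t => [|t IH]; last by rewrite trajS; exact: cstep_inv.
by case: a a2 => [|[|//]] _; rewrite /traj /= /init /= /cell_inv !cellE.
Qed.

Lemma front_step e a s m : cell_inv a s -> front (cstep e s m) ->
  [|| m == 1, (m == 3) && (a == 0) | m == 4].
Proof.
rewrite /cstep /cell_inv /front; case: ifP => _; last by rewrite cell0E.
rewrite /sstep; have [->|ne2] := eqVneq (c_tag s) 2.
  move=> inv; have {inv} -> : a == 0 by lia.
  by case: ifP => [|_]; [lia|case: ifP => _; rewrite cellE].
have [-> _|ne1 _] := eqVneq (c_tag s) 1; last by rewrite cellE.
by case: ifP => [|_] /=; [lia|case: ifP => _; rewrite cellE].
Qed.

Lemma emit_front b s : cell_inv b s ->
  [/\ emit s != 1, emit s == 3 -> front s && (b == 0) & emit s == 4 -> front s && (b == 1)].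
Proof.
by rewrite /cell_inv /emit /front; case: ifP => ? ?; split=> //; lia.
Qed.

(* The boundary signal only survives in words of the form [a^x b^y]. *)
Lemma front_sorted e a w t : all (fun x => x < 2) (a :: w) ->
  front (traj e a w t) -> t = (size w).+1 /\ sorted leq (a :: w).
Proof.
elim: w a t => [|b w IH] a t /=; rewrite ?andbT => ab.
  case: t => [|t]; first by rewrite /traj /= /init /front; case: ifP; rewrite cellE.
  move=> /(front_step (traj_inv e [::] t ab)) /=.
  by case: t.
case/andP: ab => a2 /andP[b2 w2].
case: t => [|t]; first by rewrite /traj /= /init /front; case: ifP; rewrite cellE.
move=> /(front_step (traj_inv e (b :: w) t a2)); rewrite recv_cons.
have [e1 e3 e4] := emit_front (traj_inv e w t b2).
(* The boundary signal moves one cell per step, so the right neighbour carried it one step earlier;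
   a [b] does not accept it from an [a]. *)
move=> H; have {H} /andP[fr ->] : front (traj e b w t) && (a <= b).
  move: a2 b2 e1 e3 e4 H; move: (front _) (emit _) => f m.
  by case: f; lia.
by have [|-> /= ->] := IH b t _ fr; rewrite /= ?b2.
Qed.

Lemma cstep_eq e s m c : sstep e s m = c -> c <= maxcell e -> cstep e s m = c.
Proof. by rewrite /cstep => -> ->. Qed.

Lemma cstep_dead e tag msg m : (tag == 1) || (tag == 2) = false ->
  cstep e (cell tag 0 0 0 0 msg) m = cell 0 0 0 0 0 0.
Proof.
move=> ne; apply: cstep_eq; last exact: cell_leq3.
rewrite /sstep !cellE.
by have [/negPf -> /negPf ->] : tag != 2 /\ tag != 1 by lia.
Qed.

Lemma cstep_b e msg m : cstep e (cell 1 0 0 0 0 msg) m =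
  if (m == 1) || (m == 4) then cell 4 0 0 0 0 3 else
  if m == 3 then cell 0 0 0 0 0 0 else cell 1 0 0 0 0 0.
Proof.
apply: cstep_eq; first by rewrite /sstep !cellE.
by do 2?[case: ifP => _]; rewrite cell_leq3.
Qed.

Lemma cstep_a_front e ac h p1 p2 msg m : (m == 1) || ((m == 3) || (m == 4)) ->
  cstep e (cell 2 ac h p1 p2 msg) m =
  cell (if h == (e + nfst e).+1 then 3 else 4) 0 0 0 0 2.
Proof.
move=> em; apply: cstep_eq; first by rewrite /sstep !cellE /= em.
by rewrite cell_leq3 //; case: ifP.
Qed.

Lemma emitE tag ac h p1 p2 m :
  emit (cell tag ac h p1 p2 m) = if m == 0 then 0 else m.+1.
Proof. by rewrite /emit cellE. Qed.

(** * Trajectories of the cells on words [a^x b^y] *)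

Lemma traj_b e y t : traj e 1 (nseq y 1) t =
  if t == 0 then cell 1 0 0 0 0 1 else if t <= y then cell 1 0 0 0 0 0 else
  cell (if t == y.+1 then 4 else 0) 0 0 0 0 (if t == y.+1 then 3 else 0).
Proof.
elim: y t => [|y IHy]; case=> // t; elim: t => [|t IHt]; rewrite trajS.
- by rewrite cstep_b.
- by rewrite IHt /= cstep_dead; last by case: ifP.
- by rewrite cstep_b recv_cons IHy emitE.
rewrite IHt recv_cons IHy /=; have [ty|yt] := leqP t.+1 y.+1.
  rewrite cstep_b; have [ty'|yt'] := ltnP t y; first by rewrite emitE /= ltnS ty'.
  have -> : t = y by lia.
  by rewrite emitE !eqxx /= ltnn.
rewrite cstep_dead; last by case: ifP.
by do 3?[case: ifP; first by lia].
Qed.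

Lemma traj_a e x t : traj e 0 (nseq x 0) t =
  if t <= x then cell 2 0 0 0 0 0 else
  cell (if t == x.+1 then 4 else 0) 0 0 0 0 (if t == x.+1 then 2 else 0).
Proof.
have idle : cstep e (cell 2 0 0 0 0 0) 0 = cell 2 0 0 0 0 0.
  apply: cstep_eq; last exact: cell_leq3.
  rewrite /sstep !cellE /= sub0n -[nfst 0]/(c_tag 0) cell0E /=.
  by rewrite (_ : nsnd 0 = 0) // /nsnd div0n.
elim: x t => [|x IHx]; case=> // t; elim: t => [|t IHt]; rewrite trajS.
- by rewrite cstep_a_front.
- by rewrite IHt /= cstep_dead; last by case: ifP.
- by rewrite recv_cons IHx emitE idle.
rewrite IHt recv_cons IHx /=; have [ty|yt] := leqP t.+1 x.+1.
  have [ty'|yt'] := ltnP t x; first by rewrite emitE idle ltnS ty'.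
  have -> : t = x by lia.
  by rewrite !eqxx emitE ltnn cstep_a_front.
rewrite cstep_dead; last by case: ifP.
by do 3?[case: ifP; first by lia].
Qed.

(* State at time [t] of the [n.+1]st cell to the left of the border: it sends the
   program counter at time [2n+2] and the mark of register [i] at time [2n+2+r_i],
   where [r] is the register content after [n] steps.  Thus marks are delayed by 2
   from one cell to the next, by 3 for an increment and by 1 for a decrement. *)
Definition acell e n t :=
  let tau i := n.*2.+2 + reg_at e n i in let A := action_at e n in
  cell 2 (if n.*2 < t then A else 0) (if t.+1 == n.*2.+2 then (pc_at e n).+1 else 0)
    (msum e.+1 (fun i => (t.+1 == tau i) && (A != i.*2.+2)))
    (msum e.+1 (fun i => (t.+2 == tau i) && (A == i.*2.+1)))
    (marks (if t == n.*2.+2 then (pc_at e n).+1 else 0) (msum e.+1 (fun i => t == tau i))).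

Lemma msum_bound e (f : nat -> bool) : msum e.+1 f <= bound e.
Proof.
by apply: leq_trans (ltnW (msum_lt _ _)) _; rewrite /bound leq_exp2l //; lia.
Qed.

Lemma small_bound e n : n <= e.*2.+2 -> n <= bound e.
Proof.
move=> ne; have := ltn_expl e (isT : 1 < 2); rewrite /bound !expnS; lia.
Qed.

Lemma acell_leq e n t : acell e n t <= maxcell e.
Proof.
have pc := pc_at_leq e n; apply: cell_leq => //; try exact: msum_bound.
- case: ifP => // _; apply: small_bound; case: n {pc} => // n.
  exact: action_leq.
- by case: ifP => // _; apply: small_bound; lia.
- by case: ifP => // _; apply: small_bound; lia.
Qed.

(** The offset 4 is the 3 of [marks] plus the 1 added by [emit]. Silence decodes as two zeros, since
    truncated subtraction and unpairing send 0 to 0. *)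
Lemma emit_marks ac h p1 p2 o z (m := emit (cell 2 ac h p1 p2 (marks o z))) :
  [/\ nfst (m - 4) = o, nsnd (m - 4) = z, m != 1, m != 2 & (m == 3) || (m == 4) = false].
Proof.
rewrite /m emitE /marks.
have [/andP[/eqP -> /eqP ->]|_] := boolP ((o == 0) && (z == 0)).
  by rewrite /= nfstE /nsnd div0n.
rewrite addSn /= !addSn add0n subSS subSS subSS subSS subn0 nfst_pair nsnd_pair.
by have := npair_gt0 o z; split; lia.
Qed.

Lemma msum_eq0 m f : (forall i, f i = 0) -> msum m f = 0.
Proof. by move=> f0; rewrite -(msum0 m); apply: eq_msum => i _; rewrite f0. Qed.

#[local] Arguments action_at : simpl never.

(** Passage to the next column on the left. An arriving mark goes through [c_p1] and leaves two
    steps later; an increment puts it into [c_p2] first (three steps), a decrement sends it at once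
    (one step). Only the message of the right neighbour matters, hence the arbitrary other
    fields. *)
Lemma acell_step e n t ac h p1 p2 (tau := fun i => n.*2.+2 + reg_at e n i) :
  cstep e (acell e n.+1 t)
    (emit (cell 2 ac h p1 p2
       (marks (if t == n.*2.+2 then (pc_at e n).+1 else 0) (msum e.+1 (fun i => t == tau i)))))
  = acell e n.+1 t.+1.
Proof.
set o := if _ then _ else _; set z := msum _ _; set s := cell 2 _ _ _ _ _.
have [eo ez m1 m2 m34] := emit_marks ac h p1 p2 o z.
apply: cstep_eq; last exact: acell_leq.
rewrite /sstep {1}/acell cellE /= (negPf m1) m34 (negPf m2) /= eo ez.
set A := action_at e n.+1.
(* The marks travelling with the program mark are those of the zero registers, so the received mask
   is the one that the instruction tests. *)
have zE : t = n.*2.+2 -> z = zeros e n.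
  by move=> et; apply: eq_msum => i _; rewrite /tau et; case: (reg_at e n i) => [|r]; lia.
have -> : (if o == 0 then c_ac (acell e n.+1 t) else action e o.-1 z) =
    if n.*2.+2 <= t then A else 0.
  rewrite /o /acell cellE -/A doubleS; case: (eqVneq t n.*2.+2) => [et|ne] /=.
    by rewrite (zE et) et leqnn.
  by rewrite ltn_neqAle eq_sym ne.
have -> : (if o == 0 then 0 else (next_pc e o.-1 z).+1) =
    if t.+2 == n.+1.*2.+2 then (pc_at e n.+1).+1 else 0.
  rewrite /o doubleS !eqSS; case: (eqVneq t n.*2.+2) => [et|ne] //=.
  by rewrite pc_atS (zE et).
clear eo ez m1 m2 m34 s zE o.
set act := if _ <= _ then A else 0; set i := _ %/ 2; set b := (act != 0) && _.
have Ale : A <= e.*2.+2 := action_leq _ _ _.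
have ie : i < e.+1.
  have : act <= e.*2.+2 by rewrite /act; case: ifP.
  by rewrite /i; lia.
have eb : b = (act != 0) && (t == tau i) by rewrite /b /z bit_msum.
(* Single-bit masks are rewritten as sums over all registers [j], so that fields can be compared bit
   by bit. That [act] is 0 before the program mark arrives does no harm, as no register mark comes
   earlier. *)
have b1 j : (b && odd act) && (j == i) = (A == j.*2.+1) && (t == tau j).
  have [->|ji] := eqVneq j i; last first.
    rewrite andbF; move: ji; rewrite /i /act /tau; case: ifP => ?; lia.
  by rewrite eb /i /act /tau; case: ifP => ?; lia.
have b2 j : (b && ~~ odd act) && (j == i) = (A == j.*2.+2) && (t == tau j).
  have [->|ji] := eqVneq j i; last first.
    rewrite andbF; move: ji; rewrite /i /act /tau; case: ifP => ?; lia.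
  by rewrite eb /i /act /tau; case: ifP => ?; lia.
clearbody b; have b3 j : b && (j == i) = ((A == j.*2.+1) || (A == j.*2.+2)) && (t == tau j).
  by rewrite andb_orl -b1 -b2 -!andb_orl -andb_orr orbN andbT.
rewrite -!(@msum1 e.+1 _ i ie) /acell !cellE -/A; congr cell.
- apply: (canLR (addnK _)); rewrite !msum_add; apply: eq_msum => j _.
  rewrite b3 reg_atS -/A; have := @action_at_dec e n j; rewrite -/A /tau => pos.
  case: (eqVneq A j.*2.+1) => ?; first by lia.
  by case: (eqVneq A j.*2.+2) => ?; lia.
- apply: eq_msum => j _; rewrite b1 reg_atS -/A /tau.
  by case: (eqVneq A j.*2.+1) => ?; lia.
rewrite msum_add; congr marks; apply: eq_msum => j _.
rewrite b2 reg_atS -/A; have := @action_at_dec e n j; rewrite -/A /tau => pos.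
case: (eqVneq A j.*2.+1) => ?; first by lia.
by case: (eqVneq A j.*2.+2) => ?; lia.
Qed.

Lemma acell_init e n : acell e n 0 = cell 2 0 0 0 0 0.
Proof.
rewrite /acell ltn0 eqSS (_ : 0 == n.*2.+1 = false) // (_ : 0 == n.*2.+2 = false) //.
rewrite !msum_eq0 //.
by case: n => [|n] i; rewrite ?eqSS //= andbC.
Qed.

(** Next to the border all registers are 0, so the mask is all ones, [2 ^ e.+1 - 1]; the symbol 2 is
    the message 1 of the first [b]. *)
Lemma acell_start e t : cstep e (acell e 0 t) (if t == 0 then 2 else 0) = acell e 0 t.+1.
Proof.
apply: cstep_eq; last exact: acell_leq.
case: t => [|t] /=.
  rewrite acell_init /sstep cellE /= /acell /= -msumT.
  by congr cell; [rewrite msum_eq0|rewrite msum_eq0].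
rewrite /sstep /acell !cellE /=.
have -> : nfst (0 - 4) = 0 by rewrite nfstE.
have -> : nsnd (0 - 4) = 0 by rewrite /nsnd div0n.
rewrite /= !addn0; congr cell.
- by rewrite subn0 !msum_eq0 // => i; rewrite andbC.
- by rewrite msum_eq0 // => i; rewrite andbC.
by congr marks; apply: eq_msum => i _; rewrite andbT.
Qed.

Lemma cstep_acell_front e n t m : (m == 1) || ((m == 3) || (m == 4)) ->
  cstep e (acell e n t) m =
  cell (if (t.+1 == n.*2.+2) && (pc_at e n == e + nfst e) then 3 else 4) 0 0 0 0 2.
Proof.
by move=> em; rewrite cstep_a_front //; case: (t.+1 == n.*2.+2).
Qed.

Lemma emit_acell e n t : emit (acell e n t) =
  emit (cell 2 0 0 0 0 (marks (if t == n.*2.+2 then (pc_at e n).+1 else 0)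
                      (msum e.+1 (fun i => t == n.*2.+2 + reg_at e n i)))).
Proof. by rewrite !emitE. Qed.

(** The boundary signal is received at time [n + y.+1], while the program counter sits in [c_h] at
    time [n.*2.+1]; the times agree iff [y = n]. *)
Lemma traj_ab e n y t : traj e 0 (nseq n 0 ++ nseq y.+1 1) t =
  if t <= n + y.+1 then acell e n t else
  cell (if t == n + y.+2 then
          if (y == n) && (pc_at e n == e + nfst e) then 3 else 4 else 0)
    0 0 0 0 (if t == n + y.+2 then 2 else 0).
Proof.
elim: n t => [|n IHn]; case=> [|t]; try by rewrite acell_init.
  elim: t => [|t IHt]; rewrite trajS.
    rewrite (_ : traj _ _ _ 0 = acell e 0 0) ?acell_init // recv_cons traj_b emitE.
    by rewrite -(acell_init e 0) (acell_start e 0).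
  rewrite IHt recv_cons traj_b (_ : t.+1 == 0 = false) // !add0n ltnS.
  have [ty|yt] := leqP t y.
    have [ty'|yt'] := ltnP t y; first by rewrite emitE /= (acell_start e t.+1) ltnS ty'.
    have {ty yt'} -> : t = y by lia.
    by rewrite !eqxx emitE cstep_acell_front // !eqSS double0 ltnn.
  rewrite cstep_dead; last by do 2?case: ifP.
  by rewrite ltnS ltnNge (ltnW yt) /= (_ : t.+2 == y.+2 = false) //; lia.
elim: t => [|t IHt]; rewrite trajS.
  rewrite (_ : traj _ _ _ 0 = acell e n.+1 0) ?acell_init // recv_cons IHn /=.
  by rewrite -(acell_init e n.+1) emit_acell acell_step.
rewrite IHt recv_cons IHn.
have [ty|yt] := leqP t.+1 (n.+1 + y.+1).
  have [ty'|yt'] := leqP t.+1 (n + y.+1).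
    by rewrite emit_acell acell_step (_ : t.+1 < n.+1 + y.+1) //; lia.
  have -> : t.+1 = n + y.+2 by lia.
  rewrite eqxx emitE /= cstep_acell_front //.
  rewrite (_ : _ <= _ = false); last by lia.
  rewrite (_ : (_ == n.+1.*2.+2) = (y == n.+1)); last by lia.
  by rewrite (_ : (_ == _ + y.+2) = true); last by lia.
rewrite cstep_dead; last by do 2?case: ifP.
rewrite (_ : (_ <= _) = false); last by lia.
by rewrite (_ : (_ == _ + y.+2) = false); last by lia.
Qed.

Definition word x y : seq nat := nseq x 0 ++ nseq y 1.

Lemma size_word x y : size (word x y) = x + y.
Proof. by rewrite size_cat !size_nseq. Qed.

Lemma all_word x y : all (fun a => a < 2) (word x y).
Proof. by apply/allP => a; rewrite mem_cat => /orP[] /nseqP[->]. Qed.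

Lemma sorted_wordE x y : sorted leq (word x y).
Proof.
elim: x => [|x IH]; last by rewrite /= path_min_sorted //; apply/allP.
by elim: y => [|y] //= IH; rewrite path_min_sorted //; apply/allP => a /nseqP[->].
Qed.

Lemma sorted_word w : all (fun a => a < 2) w -> sorted leq w ->
  exists x y, w = word x y.
Proof.
elim: w => [|a w IH] /=; first by exists 0, 0.
case/andP=> a2 w2 aw; have [x [y e]] := IH w2 (path_sorted aw).
case: a a2 aw => [|[|//]] _ aw; first by exists x.+1, y; rewrite e.
case: x e => [|x] e; first by exists 0, y.+1; rewrite e.
by move: aw; rewrite e.
Qed.

(* The machine has made [n] steps when its signal reaches the [n.+1]st cell to the
   left of the border between the letters; the boundary signal, twice as fast,
   catches up with it there iff it started [n.+1] cells to the right of the border. *)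
Definition hits e w := exists2 n, w = word n.+1 n.+1 & pc_at e n = e + nfst e.

Lemma word_inj x y x' y' : word x y = word x' y' -> x = x' /\ y = y'.
Proof.
move=> e; have ex := congr1 (count_mem 0) e; have ey := congr1 (count_mem 1) e.
by move: ex ey; rewrite !count_cat !count_nseq /=; lia.
Qed.

(** Tag 4 is a boundary signal that survived but failed the check, so accepting it yields the
    complement within the sorted words. *)
Definition good_tag f := if f then 4 else 3.

Lemma traj_front e x y a w : word x y = a :: w ->
  c_tag (traj e a w (size w).+1) =
  if [&& 0 < y, x == y & pc_at e x.-1 == e + nfst e] then 3 else 4.
Proof.
case: x => [|x] /=.
  by case: y => [|y] //= -[<- <-]; rewrite size_nseq traj_b /= ltnn eqxx cellE.
case: y => [|y] [<- <-].
  by rewrite cats0 size_nseq traj_a ltnn eqxx cellE.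
rewrite size_cat /= !size_nseq traj_ab [x + y.+2]addnS ltnn eqxx cellE eqSS [y == x]eq_sym.
by case: ifP.
Qed.

Lemma front_hits e x y : reflect (hits e (word x y))
  [&& 0 < y, x == y & pc_at e x.-1 == e + nfst e].
Proof.
apply: (iffP and3P) => [[y0 /eqP-> /eqP eq]|[n /word_inj[-> ->] ->]]; last by rewrite !eqxx.
by exists y.-1; rewrite // prednK.
Qed.

(** * The automaton as an [OCA], its language and its communication *)

Definition mcode n (m : option (option 'I_n)) : nat :=
  if m is Some m' then if m' is Some b then b.+2 else 1 else 0.

Lemma val_inord n x : val (inord x : 'I_n.+1) = if x <= n then x else 0.
Proof. by rewrite /inord val_insubd. Qed.

Lemma c_msg_leq s : c_msg s <= s.
Proof.
have le n : nsnd n <= n by have := nsnd_leq n; lia.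
by rewrite /c_msg; do ?[apply: leq_trans (le _) _].
Qed.

Lemma step_cons M t s c : step M t (s :: c) =
  delta M (s, if c is s' :: _ then sent M s' else if t == 0 then Some None else None)
  :: step M t c.
Proof. by case: c. Qed.

Lemma configS M w t : config M w t.+1 = step M t (config M w t).
Proof. by []. Qed.

Lemma val_word_ord (u : seq nat) : all (fun a => a < 2) u ->
  exists w : seq 'I_2, map val w = u.
Proof.
move=> u2; exists [seq inord a | a <- u]; rewrite -map_comp.
by apply: map_id_in => a /(allP u2) a2; rewrite /= inordK.
Qed.

Lemma all_val (w : seq 'I_2) : all (fun a => a < 2) (map val w).
Proof. by apply/allP => _ /mapP[a _ ->]; apply: ltn_ord. Qed.

Lemma drop_word n x y : exists x' y', drop n (word x y) = word x' y'.
Proof.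
apply: sorted_word; last exact/drop_sorted/sorted_wordE.
by apply/allP => a /mem_drop; exact: (allP (all_word x y)).
Qed.

Section Automaton.
Variables (f : bool) (e : nat).
Let N := maxcell e.

Definition oca : OCA := @MkOCA N.+1 2 N.+1
  [ffun a : 'I_2 => inord (init a)]
  [set s : 'I_N.+1 | c_tag s == good_tag f]
  [ffun s : 'I_N.+1 => if c_msg s == 0 then None else Some (inord (c_msg s).-1)]
  [ffun p : 'I_N.+1 * option (option 'I_N.+1) => inord (sstep e p.1 (mcode p.2))].

(** Message [m] is sent as the symbol [m.-1], and [mcode] adds 2 to make room for silence and
    boundary; together this is the shift by one in [emit]. *)
Lemma mcode_sent (s : 'I_(nS oca)) : mcode (sent oca s) = emit s.
Proof.
rewrite /sent ffunE /emit; case: eqP => // /eqP; rewrite -lt0n => m0 /=.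
rewrite val_inord.
have := c_msg_leq s; have := ltn_ord s; rewrite [nS oca]/= => sN ms.
by rewrite ifT; lia.
Qed.

Fixpoint trajs (w : seq nat) t :=
  if w is a :: w' then traj e a w' t :: trajs w' t else [::].

Lemma init_leq (a : nat) : init a <= N.
Proof. by rewrite /init; case: ifP => _; apply: cell_leq3. Qed.

(** Bridge from global configurations to single cells, each following the trajectory of the suffix
    that starts at it. *)
Lemma val_config (w : seq 'I_2) t :
  map val (config oca w t) = trajs (map val w) t.
Proof.
elim: t => [|t].
  by elim: w => //= a w <-; rewrite ffunE val_inord init_leq.
rewrite configS; move: (config oca w t) => c.
elim: w c => [|a w IH] [|s c] //= [es ec]; rewrite step_cons map_cons IH //.
congr cons; rewrite ffunE val_inord trajS /= -es /cstep.
suff -> : mcode (if c is s' :: _ then sent oca s'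
            else if t == 0 then Some None else None) = recv e (map val w) t by [].
clear IH es; case: c w ec => [|s' c] [|b w] //= => [_|[es' _]]; first by case: eqP.
by rewrite mcode_sent [nat_of_ord s']es'.
Qed.

Lemma acc_atE (w : seq 'I_2) t : acc_at oca w t =
  if map val w is a :: w' then c_tag (traj e a w' t) == good_tag f else false.
Proof.
have := val_config w t; rewrite /acc_at.
by case: (config oca w t) (map val w) => [|s c] [|a w'] //= [<- _]; rewrite inE.
Qed.

Lemma acc_at_sorted (w : seq 'I_2) t : acc_at oca w t ->
  t = size w /\ sorted leq (map val w).
Proof.
rewrite acc_atE; have := all_val w; rewrite -(size_map val).
case: (map val w) => // a u ab tag; apply: (@front_sorted e a u t ab).
by rewrite /front (eqP tag) /good_tag; case: f.
Qed.

Lemma acc_at_word (w : seq 'I_2) x y : map val w = word x y -> w != [::] ->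
  acc_at oca w (size w) = (f != [&& 0 < y, x == y & pc_at e x.-1 == e + nfst e]).
Proof.
move=> ew w0; rewrite acc_atE -(size_map val).
case ew' : (map val w) => [|a u] /=; first by case: w w0 ew' {ew}.
rewrite (@traj_front _ x y) -?ew // /good_tag.
by case: ifP => _; case: f.
Qed.

Lemma oca_realtime : realtime oca.
Proof. by move=> w [t acc]; exists t => //; have [-> _] := acc_at_sorted acc. Qed.

Lemma oca_bounded : bounded oca.
Proof. by move=> _ [w [-> [t /acc_at_sorted[_ ->]]]]. Qed.

Lemma oca_valid : valid oca.
Proof.
move=> a b; rewrite /= !ffunE => /(congr1 val); rewrite !val_inord !init_leq.
by case: a b => [[|[|a]] //= ia] [[|[|b]] //= ib] e1; apply: val_inj => //;
   move: (congr1 c_tag e1); rewrite /init /= !cellE.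
Qed.

Lemma lang_oca u : lang oca u <->
  [/\ u != [::], all (fun a => a < 2) u, sorted leq u & if f then ~ hits e u else hits e u].
Proof.
split=> [[w [-> [t acc]]]|[u0 u2 us uh]].
  have w0 : w != [::] by case: w acc => //; rewrite acc_atE.
  have [et sw] := acc_at_sorted acc; have aw := all_val w.
  split=> //; first by case: (w) w0.
  have [x [y ew]] := sorted_word aw sw.
  move: acc; rewrite et (acc_at_word ew w0) ew.
  by case: front_hits => //; case: f.
have [w ew] := val_word_ord u2; have [x [y exy]] := sorted_word u2 us.
exists w; split=> //; exists (size w).
have w0 : w != [::] by case: w ew u0 => // <-.
rewrite (@acc_at_word w x y) ?ew //.
by move: uh; rewrite exy; case: front_hits; case: f.
Qed.

(** A cell left of the border sends the boundary signal, the program mark and one mark per register,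
    at most [e + 3] messages whatever the length of the word; a [b] sends at most two. *)
Lemma emit_times x y a w : word x y = a :: w ->
  exists2 l : seq nat, size l <= e + 4 &
    forall t, emit (traj e a w t) != 0 -> t \in l.
Proof.
case: x => [|n].
  case: y => [|y] //= [<- <-]; exists [:: 0; y.+1] => [|t]; first by rewrite addnC.
  rewrite traj_b !inE; case: (t == 0) => //; case: (t <= y); rewrite emitE //.
  by case: (t == y.+1).
case: y => [|y] [<- <-].
  exists [:: n.+1] => [|t]; first by rewrite addnC.
  rewrite cats0 traj_a inE; case: (t <= n); rewrite emitE //.
  by case: (t == n.+1).
exists [:: n + y.+2, n.*2.+2 & [seq n.*2.+2 + reg_at e n i | i <- iota 0 e.+1]] => [|t].
  by rewrite /= size_map size_iota; lia.
rewrite traj_ab 2!in_cons; case: (t <= _); last by rewrite emitE; case: (t == n + y.+2).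
rewrite emitE; apply: contraR; rewrite 2!negb_or => /and3P[_ /negPf -> nl].
rewrite (_ : msum _ _ = 0) // -(msum0 e.+1); apply: eq_msum => i ie.
case: eqP => // et; case/negP: nl; rewrite et.
by apply: (map_f (fun i => n.*2.+2 + reg_at e n i)); rewrite mem_iota.
Qed.

Lemma sends_emit (w : seq 'I_2) j i : sends oca w j i =
  if drop i.+1 (map val w) is a :: u then emit (traj e a u j) != 0 else false.
Proof.
have drop_trajs n u t : drop n (trajs u t) = trajs (drop n u) t.
  by elim: u n => [|a u IH] [|n] //=.
have := drop_trajs i.+1 (map val w) j; rewrite -val_config -map_drop /sends.
move: (drop i.+1 (config oca w j)) (drop i.+1 (map val w)).
move=> [|s c] [|a u] //= [<- _].
by rewrite ffunE /emit; case: ifP.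
Qed.

Lemma com_leq w i t : acceptsW oca w -> com oca w i t <= e + 4.
Proof.
move=> [t' /acc_at_sorted[_ sw]]; have [x [y ew]] := sorted_word (all_val w) sw.
have [x' [y' ed]] := drop_word i.+1 x y.
have [l ls lP] : exists2 l : seq nat, size l <= e + 4 &
    forall j, sends oca w j i -> j \in l.
  case ed' : (drop i.+1 (map val w)) => [|a u].
    by exists [::] => // j; rewrite sends_emit ed'.
  have [|l ls lP] := @emit_times x' y' a u; first by rewrite -ed -ew.
  by exists l => // j; rewrite sends_emit ed'; apply: lP.
apply: leq_trans ls; rewrite /com -size_filter; apply: uniq_leq_size.
  by rewrite filter_uniq // iota_uniq.
by move=> j; rewrite mem_filter => /andP[/lP].
Qed.

Lemma oca_SC : SC_OCA_lin oca.
Proof.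
exists (fun n => (e + 4) * n); split; first by exists (e + 4), 0.
move=> w acc; rewrite /scom; apply: (@leq_trans (\sum_(i < (size w).-1) (e + 4))).
  by apply: leq_sum => i _; exact: com_leq.
by rewrite sum_nat_const card_ord mulnC leq_mul2l leq_pred orbT.
Qed.

Lemma oca_MC : MC_OCA_log oca.
Proof.
exists (fun n => e + 4); split.
  (* The threshold is 2 because the logarithm is at least 1 from there on. *)
  exists (e + 4), 2 => n n2; rewrite leq_pmulr //.
  exact: (@trunc_log_max 2 n 1).
by move=> w acc; apply/bigmax_leqP => i _; exact: com_leq.
Qed.
End Automaton.

(** * The code of the automaton is primitive recursive in [e] *)

(** Unfolds the generic coding of finite functions into a table that a counter machine can
    compute. *)
Lemma pickle_ffun (T : finType) (U : countType) (f : {ffun T -> U}) :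
  pickle f = CodeSeq.code [seq npair (pickle x) (npair (pickle (f x)) 0) | x <- enum T].
Proof.
rewrite {1}/pickle /= {1}/pickle /= {1}/pickle /=; congr CodeSeq.code.
rewrite -codom_tffun /codom_tuple /codom /image_mem /= -!map_comp.
by apply: eq_map.
Qed.

Lemma pickle_pair (T U : countType) (p : T * U) :
  pickle p = npair (pickle p.1) (npair (pickle p.2) 0).
Proof. by case: p. Qed.

Lemma pickle_set (T : finType) (A : {set T}) :
  pickle A = CodeSeq.code [seq npair (pickle x) (npair (x \in A) 0) | x <- enum T].
Proof.
transitivity (pickle (finfun_of_set A)); first by [].
rewrite pickle_ffun; congr CodeSeq.code; apply: eq_map => x.
by rewrite /in_mem /= unlock.
Qed.

Lemma pickle_option (T : countType) (x : option T) :
  pickle x = if x is Some y then npair (pickle y) 0 else 0.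
Proof. by case: x. Qed.

Lemma pickle_oca (M : OCA) : pickle M =
  npair (pickle (nS M, k M, nB M)) (npair (pickle (inp M, accF M, bl M, delta M)) 0).
Proof. by []. Qed.

Lemma enum_mcode n : [seq mcode m | m <- enum {: option (option 'I_n)}] = iota 0 n.+2.
Proof.
rewrite enumT unlock /= /option_enum unlock /= /option_enum /= unlock.
rewrite -!map_comp -[iota 2 n]/(iota (2 + 0) n) iotaDl.
congr [:: _, _ & _]; rewrite -val_enum_ord -map_comp enumT.
by rewrite unlock.
Qed.

Lemma map_enum_ord n (F : nat -> nat) (G : 'I_n -> nat) : (forall i, G i = F i) ->
  [seq G i | i <- enum 'I_n] = [seq F i | i <- iota 0 n].
Proof. by move=> GF; rewrite -val_enum_ord -map_comp; apply: eq_map. Qed.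

Lemma allpairs_iota (G : nat -> nat -> nat) n m : 0 < m ->
  [seq G i j | i <- iota 0 n, j <- iota 0 m] =
  [seq G (l %/ m) (l %% m) | l <- iota 0 (n * m)].
Proof.
move=> m0; elim: n => // n IH; rewrite -addn1 iotaD map_cat flatten_cat IH /= cats0.
rewrite mulnDl mul1n iotaD map_cat add0n; congr cat.
rewrite [0 + _]addnC iotaDl -map_comp; apply/eq_in_map => j.
rewrite mem_iota /= => jm.
by rewrite divnMDl // divn_small // addn0 modnMDl modn_small.
Qed.

Definition clip e x := if x <= maxcell e then x else 0.
Definition pickle_msg c := if c == 0 then 0 else
  if c == 1 then npair 0 0 else npair (npair (c - 2) 0) 0.

Definition inp_table e :=
  CodeSeq.code [seq npair a (npair (clip e (init a)) 0) | a <- iota 0 2].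
Definition acc_table f e :=
  CodeSeq.code [seq npair s (npair (c_tag s == good_tag f) 0) | s <- iota 0 (maxcell e).+1].
Definition bl_table e :=
  CodeSeq.code [seq npair s (npair (if c_msg s == 0 then 0 else npair (c_msg s).-1 0) 0)
               | s <- iota 0 (maxcell e).+1].
Definition delta_entry l e := let n := (maxcell e).+3 in
  npair (npair (l %/ n) (npair (pickle_msg (l %% n)) 0))
        (npair (clip e (sstep e (l %/ n) (l %% n))) 0).
Definition delta_table e :=
  CodeSeq.code [seq delta_entry l e | l <- iota 0 ((maxcell e).+1 * (maxcell e).+3)].
Definition oca_code f e := let n := (maxcell e).+1 in
  npair (npair (npair n (npair 2 0)) (npair n 0))
    (npair (npair (npair (npair (inp_table e) (npair (acc_table f e) 0))
                         (npair (bl_table e) 0)) (npair (delta_table e) 0)) 0).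

Lemma pickle_msgE n (m : option (option 'I_n)) : pickle m = pickle_msg (mcode m).
Proof.
by case: m => [[b|]|] //; rewrite pickle_option pickle_option /pickle_msg /= subn2.
Qed.

Lemma pickle_inord n x : pickle (inord x : 'I_n.+1) = if x <= n then x else 0.
Proof. exact: val_inord. Qed.

Lemma oca_codeE f e : pickle (oca f e) = oca_code f e.
Proof.
rewrite pickle_oca !pickle_pair /= /oca_code; set n := (maxcell e).+1.
have inE_table : pickle (inp (oca f e)) = inp_table e.
  rewrite pickle_ffun /inp_table; congr CodeSeq.code.
  by apply: map_enum_ord => a; rewrite ffunE pickle_inord.
have accE : pickle (accF (oca f e)) = acc_table f e.
  rewrite pickle_set /acc_table; congr CodeSeq.code.
  by apply: (@map_enum_ord n _ _) => s; rewrite inE.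
have blE : pickle (bl (oca f e)) = bl_table e.
  rewrite pickle_ffun /bl_table; congr CodeSeq.code.
  apply: (@map_enum_ord n _ _) => s; rewrite ffunE; congr npair; congr npair.
  rewrite pickle_option; case: ifP => // _; congr npair; rewrite pickle_inord.
  have sn : s < n := ltn_ord s; rewrite ifT //.
  have H x : x < (maxcell e).+1 -> (c_msg x).-1 <= maxcell e.
    by have := c_msg_leq x; lia.
  exact: H.
have dE : pickle (delta (oca f e)) = delta_table e.
  rewrite pickle_ffun /delta_table; congr CodeSeq.code.
  pose G i j := npair (npair i (npair (pickle_msg j) 0)) (npair (clip e (sstep e i j)) 0).
  transitivity [seq G i j | i <- iota 0 n, j <- iota 0 n.+2]; last exact: allpairs_iota.
  rewrite -(enum_mcode n) -(val_enum_ord n) allpairs_mapl allpairs_mapr.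
  rewrite enumT unlock /= /prod_enum map_allpairs; apply: eq_allpairs => s m.
  by rewrite pickle_pair ffunE pickle_msgE pickle_inord.
by rewrite -[LHS]/(npair (npair (npair n (npair 2 0)) (npair n 0))
    (npair (npair (npair (npair (pickle (inp (oca f e))) (npair (pickle (accF (oca f e))) 0))
      (npair (pickle (bl (oca f e))) 0)) (npair (pickle (delta (oca f e))) 0)) 0))
  inE_table accE blE dE.
Qed.

Lemma pr_fetch f g : pr f -> pr g -> pr (fun v => fetch (f v) (g v)).
Proof. by move=> Hf Hg; rewrite /fetch; pr_tac. Qed.

Lemma pr_bit f g : pr f -> pr g -> pr (fun v => bit (f v) (g v)).
Proof. by move=> Hf Hg; rewrite /bit; pr_tac. Qed.

Lemma pr_double f : pr f -> pr (fun v => (f v).*2).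
Proof.
move=> Hf; apply: (@eq_pr (fun v => f v + f v)); last exact: pr_add.
by move=> v; rewrite addnn.
Qed.

Lemma pr_next_pc f g h : pr f -> pr g -> pr h -> pr (fun v => next_pc (f v) (g v) (h v)).
Proof.
move=> Hf Hg Hh; have Hx := pr_fetch Hf Hg; rewrite /next_pc.
have Hb := pr_bit Hh (pr_nfst Hx); pr_tac.
Qed.

Lemma pr_action f g h : pr f -> pr g -> pr h -> pr (fun v => action (f v) (g v) (h v)).
Proof.
move=> Hf Hg Hh; have Hx := pr_fetch Hf Hg; rewrite /action.
have Hd := pr_double (pr_nfst Hx); have Hb := pr_bit Hh (pr_nfst Hx); pr_tac.
Qed.

Lemma pr_cell f1 f2 f3 f4 f5 f6 : pr f1 -> pr f2 -> pr f3 -> pr f4 -> pr f5 -> pr f6 ->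
  pr (fun v => cell (f1 v) (f2 v) (f3 v) (f4 v) (f5 v) (f6 v)).
Proof. by move=> *; rewrite /cell; pr_tac. Qed.

Lemma pr_marks f g : pr f -> pr g -> pr (fun v => marks (f v) (g v)).
Proof. by move=> Hf Hg; rewrite /marks; pr_tac. Qed.

Lemma pr_maxcell f : pr f -> pr (fun v => maxcell (f v)).
Proof. by move=> Hf; apply: pr_cell; rewrite /bound; pr_tac. Qed.

Lemma pr_sstep f g h : pr f -> pr g -> pr h -> pr (fun v => sstep (f v) (g v) (h v)).
Proof.
move=> Hf Hg Hh; rewrite /sstep /c_tag.
have Hac : pr (fun v => c_ac (g v)) by rewrite /c_ac; pr_tac.
have Hhh : pr (fun v => c_h (g v)) by rewrite /c_h; pr_tac.
have Hp1 : pr (fun v => c_p1 (g v)) by rewrite /c_p1; pr_tac.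
have Hp2 : pr (fun v => c_p2 (g v)) by rewrite /c_p2; pr_tac.
pose o v := nfst (h v - 4); pose z v := nsnd (h v - 4).
have Ho : pr o by rewrite /o; pr_tac.
have Hz : pr z by rewrite /z; pr_tac.
pose ac v := if o v == 0 then c_ac (g v) else action (f v) (o v).-1 (z v).
have Hact := pr_action Hf (pr_pred Ho) Hz.
have Ha : pr ac by rewrite /ac; pr_tac.
pose i v := (ac v).-1 %/ 2.
have Hi : pr i by rewrite /i; pr_tac.
pose b v := (ac v != 0) && bit (z v) (i v).
have Hbit := pr_bit Hz Hi.
have Hb : pr (fun v => b v) by rewrite /b; pr_tac.
have Hn := pr_next_pc Hf (pr_pred Ho) Hz.
have Hm : pr (fun v => marks (c_h (g v)) (c_p1 (g v) + if b v && ~~ odd (ac v) then 2 ^ i v else 0)).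
  by apply: pr_marks; pr_tac.
apply: (@eq_pr (fun v =>
  if nfst (g v) == 2 then
    if (h v == 1) || ((h v == 3) || (h v == 4)) then
      cell (if c_h (g v) == (f v + nfst (f v)).+1 then 3 else 4) 0 0 0 0 2
    else if h v == 2 then cell 2 0 1 (2 ^ (f v).+1 - 1) 0 0
    else cell 2 (ac v) (if o v == 0 then 0 else (next_pc (f v) (o v).-1 (z v)).+1)
           (c_p2 (g v) + z v - if b v then 2 ^ i v else 0)
           (if b v && odd (ac v) then 2 ^ i v else 0)
           (marks (c_h (g v)) (c_p1 (g v) + if b v && ~~ odd (ac v) then 2 ^ i v else 0))
  else if nfst (g v) == 1 then
    if (h v == 1) || (h v == 4) then cell 4 0 0 0 0 3
    else if h v == 3 then cell 0 0 0 0 0 0 else cell 1 0 0 0 0 0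
  else cell 0 0 0 0 0 0)) => //.
apply: pr_if; [by pr_tac| |].
  apply: pr_if; [by pr_tac| |].
    by apply: pr_cell; pr_tac.
  apply: pr_if; [by pr_tac| |]; by apply: pr_cell; pr_tac.
apply: pr_if; [by pr_tac| |exact: pr_const].
by pr_tac.
Qed.

Lemma pr_clip f g : pr f -> pr g -> pr (fun v => clip (f v) (g v)).
Proof. by move=> Hf Hg; have Hm := pr_maxcell Hf; rewrite /clip; pr_tac. Qed.

Lemma pr_oca_code f : pr (fun v => oca_code f (v 0)).
Proof.
have Hn : pr (fun v => maxcell (v 0)) by exact: pr_maxcell (pr_var 0).
have Hn1 : pr (fun v => maxcell (v 1)) by exact: pr_maxcell (pr_var 1).
have Hinp : pr (fun v => inp_table (v 0)).
  apply: (pr_code (h := fun a e => npair a (npair (clip e (init a)) 0))); [|exact: pr_const|exact: pr_var].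
  have Hi : pr (fun v => init (v 0)) by rewrite /init; apply: pr_if; [|apply: pr_cell..]; pr_tac.
  have Hc := pr_clip (pr_var 1) Hi; pr_tac.
have Hacc : pr (fun v => acc_table f (v 0)).
  apply: (pr_code (h := fun s _ => npair s (npair (c_tag s == good_tag f) 0)) (g := fun _ => 0)); rewrite /c_tag; pr_tac.
have Hbl : pr (fun v => bl_table (v 0)).
  apply: (pr_code (h := fun s _ => npair s (npair (if c_msg s == 0 then 0 else npair (c_msg s).-1 0) 0)) (g := fun _ => 0));
    rewrite /c_msg; pr_tac.
have Hdel : pr (fun v => delta_table (v 0)).
  apply: (pr_code (h := delta_entry)); rewrite /delta_entry; try by pr_tac.
  have Hd : pr (fun v => v 0 %/ (maxcell (v 1)).+3) by pr_tac.
  have Hr : pr (fun v => v 0 %% (maxcell (v 1)).+3) by pr_tac.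
  have Hs := pr_clip (pr_var 1) (pr_sstep (pr_var 1) Hd Hr).
  by apply: pr_npair; rewrite /pickle_msg; pr_tac.
rewrite /oca_code; pr_tac.
Qed.

Lemma pr_pickle_oca f : pr (fun v => pickle (oca f (v 0))).
Proof. by apply: eq_pr (pr_oca_code f) => v; rewrite oca_codeE. Qed.

(** * Diagonalization *)

Definition marked e n := pc_at e n = e + nfst e.
Definition dead e := forall n, ~ marked e n.
(** The gap before the marked time is what defeats context-freedom; [B <= n] makes the marked times
    unbounded. *)
Definition sparse e := forall B, exists n,
  [/\ B <= n, marked e n & forall m, m < n -> n <= m + B -> ~ marked e m].

Definition instr_code i :=
  match i with INC i => npair i 0 | DEC i l => npair i l.+1 end.
Definition prog_code q (C : seq instr) := npair q (CodeSeq.code (map instr_code C)).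

#[local] Arguments mstep : simpl never.
#[local] Arguments istep : simpl never.

Lemma istep_core q C pc r (e := prog_code q C) :
  istep e (e + pc, r) = (e + (mstep C (pc, r)).1, (mstep C (pc, r)).2).
Proof.
rewrite /istep /fetch ltnNge leq_addr /= addKn nsnd_pair nnth_code.
have [lt|ge] := ltnP pc (size C); last first.
  by rewrite nth_default ?size_map // /mstep drop_oversize.
rewrite (nth_map (INC 0)) // /mstep (drop_nth (INC 0)) //.
case: (nth _ C pc) => [i|i l] /=; rewrite !(nfst_pair, nsnd_pair) gtn_eqF ?npair_gt0 //=.
  by rewrite addnS; congr pair; upd_ext.
by case e0 : (r i) => [|n] //=; rewrite addnS; congr pair; upd_ext.
Qed.

Lemma irun_prelude e n : n <= e -> irun e n = (n, upd (fun=> 0) 0 n).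
Proof.
elim: n => [|n IH] ne; first by rewrite /irun /=; congr pair; upd_ext.
rewrite /irun iterS -/(irun e n) IH; last exact: ltnW.
rewrite /istep /fetch ne /= -[1](erefl (npair 0 0)) nfst_pair nsnd_pair /=.
by congr pair; upd_ext.
Qed.

Lemma irun_core q C n (e := prog_code q C) :
  irun e (n + e) = (e + (iter n (mstep C) (0, upd (fun=> 0) 0 e)).1,
                    (iter n (mstep C) (0, upd (fun=> 0) 0 e)).2).
Proof.
rewrite /irun iterD -/(irun e e) irun_prelude //.
elim: n => [|n IH]; first by rewrite /= addn0.
by rewrite iterS IH istep_core iterS; case: (iter n _ _).
Qed.

(** Clipping by [minn] sends every halting jump to the first address after the relocated program. *)
Definition reloc a m i :=
  match i with INC i => INC i | DEC i l => DEC i (a + minn l m) end.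

Lemma reloc_run A P tl n r pc r' : iter n (mstep P) (0, r) = (pc, r') ->
  exists n', iter n' (mstep (A ++ map (reloc (size A) (size P)) P ++ tl)) (size A, r) =
             (size A + minn pc (size P), r').
Proof.
elim: n pc r' => [|n IH] pc r' /=; first by case=> <- <-; exists 0; rewrite min0n addn0.
case e1 : (iter n _ _) (IH) => [pc1 r1] /(_ _ _ erefl) [n1 e2].
have [ge|lt] := leqP (size P) pc1.
  by rewrite /mstep drop_oversize // => -[<- <-]; exists n1.
move=> e3; exists n1.+1; rewrite iterS e2; move: e3.
rewrite (minn_idPl (ltnW lt)) /mstep drop_cat ltnNge leq_addr /= addKn.
rewrite drop_cat size_map lt (drop_nth (INC 0)) // (drop_nth (INC 0)) ?size_map //.
rewrite (nth_map (INC 0)) //; case: (nth _ P pc1) => [i|i l] /=.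
  by case=> <- <-; rewrite (minn_idPl lt) addnS.
case: (r1 i) => [|m] [<- <-] //.
by rewrite (minn_idPl lt) addnS.
Qed.

(* Register 0 holds the answer 0 or 1 and serves as the zero register after it has
   been tested; 2 is an endless loop, and the loop starting at 3 doubles back to
   its first instruction after longer and longer delays. *)
Definition tail o (b : bool) : seq instr :=
  let spin := o + 2 in let gaps := o + 3 in
  [:: DEC 0 (if b then spin else gaps); DEC 0 (if b then gaps else spin);
      DEC 0 spin;
      INC 1; DEC 2 (o + 7); INC 1; DEC 0 (o + 4); DEC 1 gaps; INC 2; DEC 0 (o + 7)].

Section Tail.
Variables (A : seq instr) (b : bool).
Let o := size A.
Let C := A ++ tail o b.
Let f := mstep C.

Lemma tailE j r : f (o + j, r) = match drop j (tail o b) with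
  | INC i :: _ => ((o + j).+1, fun j => if j == i then (r j).+1 else r j)
  | DEC i l :: _ =>
      if r i is n.+1 then ((o + j).+1, fun j => if j == i then n else r j) else (l, r)
  | [::] => (o + j, r)
  end.
Proof. by rewrite /f /mstep /C drop_cat ltnNge leq_addr /= addKn. Qed.

(** No jump leads out of the loop at [o + 3], so a run that is found at [o + 2] cannot have passed
    through that loop. *)
Lemma tail_closed s : o + 3 <= s.1 -> o + 3 <= (f s).1.
Proof.
case: s => pc r /= le; have -> : pc = o + (3 + (pc - o - 3)) by lia.
rewrite tailE; move: (pc - o - 3) => j.
do 7 (case: j => [|j]; first by rewrite /=; try (case: (r _) => [|?]); rewrite /=; lia).
by rewrite /= addnA leq_addr.
Qed.

Lemma tail_closed_iter n s : o + 3 <= s.1 -> o + 3 <= (iter n f s).1.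
Proof. by move=> le; elim: n => //= n IH; apply: tail_closed. Qed.

Lemma tail_spin n r : r 0 = 0 -> iter n f (o + 2, r) = (o + 2, r).
Proof. by move=> r0; elim: n => //= n ->; rewrite tailE /= r0. Qed.

Lemma tail_start (a : bool) (r : state) : r 0 = a ->
  exists n r', r' 0 = 0 /\ iter n f (o, r) = (if a == b then o + 3 else o + 2, r').
Proof.
move=> ra; have := tailE 0 r; rewrite addn0 /=.
case: a ra => ra; rewrite ra /= => e1.
  exists 2; eexists; split; last by rewrite /= e1 -addn1 tailE /=; case: (b).
  by [].
by exists 1, r; rewrite /= e1; split=> //; case: (b).
Qed.

Definition quiet n s s' :=
  iter n f s = s' /\ forall j, 0 < j <= n -> (iter j f s).1 <> o + 3.

Lemma quiet1 s s' : f s = s' -> s'.1 <> o + 3 -> quiet 1 s s'.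
Proof. by move=> fs ne; split=> //= -[|[|j]] //= _; rewrite fs. Qed.

Lemma quiet_trans n m s1 s2 s3 : quiet n s1 s2 -> quiet m s2 s3 -> quiet (n + m) s1 s3.
Proof.
move=> [e1 q1] [e2 q2]; split=> [|j jnm]; first by rewrite addnC iterD e1.
have [jn|nj] := leqP j n; first by apply: q1; lia.
by rewrite -(subnK (ltnW nj)) iterD e1; apply: q2; lia.
Qed.

Variable r : state.
Hypothesis r0 : r 0 = 0.
Definition uv u v : state := fun j => if j == 1 then u else if j == 2 then v else r j.

Lemma tail_stepA u v : quiet 3 (o + 4, uv u v.+1) (o + 4, uv u.+1 v).
Proof.
apply: (@quiet_trans 1 2 _ (o + 5, uv u v)).
  apply: quiet1 => /=; last by lia.
  by rewrite tailE /= -addnS; congr pair; rewrite /uv; upd_ext.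
apply: (@quiet_trans 1 1 _ (o + 6, uv u.+1 v)).
  apply: quiet1 => /=; last by lia.
  by rewrite tailE /= -addnS; congr pair; rewrite /uv; upd_ext.
apply: quiet1 => /=; last by lia.
by rewrite tailE /= /uv /= r0.
Qed.

Lemma tail_loopA u v : exists2 n, v <= n & quiet n (o + 4, uv u v) (o + 7, uv (u + v) 0).
Proof.
elim: v u => [|v IH] u.
  exists 1 => //; apply: quiet1 => /=; last by lia.
  by rewrite tailE /= addn0.
have [n vn qn] := IH u.+1; exists (3 + n); first by lia.
by rewrite -[u + _]addSnnS; apply: quiet_trans qn; apply: tail_stepA.
Qed.

Lemma tail_loopB u v : exists n, quiet n (o + 7, uv u v) (o + 7, uv 0 (u + v)).
Proof.
elim: u v => [|u IH] v; first by exists 0; split=> // j; lia.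
have [n qn] := IH v.+1; exists (3 + n).
rewrite [u.+1 + v]addSnnS; apply: quiet_trans qn.
apply: (@quiet_trans 1 2 _ (o + 8, uv u v)).
  apply: quiet1 => /=; last by lia.
  by rewrite tailE /= -addnS; congr pair; rewrite /uv; upd_ext.
apply: (@quiet_trans 1 1 _ (o + 9, uv u v.+1)).
  apply: quiet1 => /=; last by lia.
  by rewrite tailE /= -addnS; congr pair; rewrite /uv; upd_ext.
apply: quiet1 => /=; last by lia.
by rewrite tailE /= /uv /= r0.
Qed.

(** Register 2 is drained into register 1 and back, with one unit added. The draining takes at least
    [v] steps, so successive returns to [o + 3] move apart. *)
Lemma tail_cycle u v : exists n, [/\ v <= n,
  iter n.+1 f (o + 3, uv u v) = (o + 3, uv 0 (u + v).+1) &
  forall j, 0 < j <= n -> (iter j f (o + 3, uv u v)).1 <> o + 3].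
Proof.
have [n1 le1 q1] := tail_loopA u.+1 v; have [n2 q2] := tail_loopB (u.+1 + v) 0.
exists (1 + (n1 + n2)); suff [e q] : quiet (1 + (n1 + n2)) (o + 3, uv u v) (o + 7, uv 0 (u + v).+1).
  split=> //; first by lia.
  by rewrite iterS e tailE.
apply: (@quiet_trans 1 _ _ (o + 4, uv u.+1 v)).
  apply: quiet1 => /=; last by lia.
  by rewrite tailE /= -addnS; congr pair; rewrite /uv; upd_ext.
by apply: quiet_trans q1 _; rewrite addn0 in q2.
Qed.

Lemma tail_gaps B u v : exists n u' v',
  B <= v' /\ iter n f (o + 3, uv u v) = (o + 3, uv u' v').
Proof.
elim: B => [|B [n [u' [v' [Bv e]]]]]; first by exists 0, u, v.
have [m [_ e2 _]] := tail_cycle u' v'.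
exists (m.+1 + n), 0, (u' + v').+1; split; first by lia.
by rewrite iterD e e2.
Qed.

End Tail.

(* The core program computes the code of [F e] for its own number [e], runs the
   alleged decision procedure on it, and does the opposite of what the answer predicts. *)
Theorem undecidable_of_family (T : countType) (D P : T -> Prop) (F : nat -> T) (b : bool) :
  pr (fun v => pickle (F (v 0))) -> (forall e, D (F e)) ->
  (forall e, dead e -> if b then P (F e) else ~ P (F e)) ->
  (forall e, sparse e -> if b then ~ P (F e) else P (F e)) ->
  undecidable_on D P.
Proof.
move=> [g gE] DF deadP sparseP [Pr PrP].
(* Every variable is read from register 0, which the prelude has filled with [e]; the result is
   built in register 2 because register 1 must stay 0. *)
pose c := Seq (cexp (fun=> 0) 2 g) (Seq (clear 0) (mv 2 0)).
pose A0 := asm 0 c; pose A := A0 ++ map (reloc (size A0) (size Pr)) Pr.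
pose o := size A; pose C := A ++ tail o b.
(* The marked instruction is the start of the gap loop. [C] does not mention [e] but finds it in
   register 0, so the self-reference is not circular. *)
pose e := prog_code (o + 3) C; pose s0 := (0, upd (fun=> 0) 0 e).
have [n1 e1] : exists n, iter n (mstep C) s0 =
    (size A0, upd (fun=> 0) 0 (pickle (F e))).
  have ex : exec c s0.2 (upd (fun=> 0) 0 (pickle (F e))).
    apply: exec_seq; first by apply: exec_cexp => // -[|j].
    apply: exec_seq; first exact: exec_clear.
    set s := upd _ 0 0; rewrite (_ : upd _ _ _ = upd (upd s 2 0) 0 (s 2 + s 0)).
      exact: exec_mv.
    by rewrite /s gE (_ : (_ \o _) 0 = e) // /s0 /=; upd_ext.
  have [|n en] := @asm_correct _ _ _ ex erefl C [::] (map (reloc (size A0) (size Pr)) Pr ++ tail o b).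
    by rewrite /C /A -catA.
  by exists n; rewrite en /= size_asm.
have run_ans (a : bool) : computes Pr (pickle (F e)) a ->
    exists n r, r 0 = 0 /\ iter n (mstep C) s0 = (if a == b then o + 3 else o + 2, r).
  case=> n2; case e2 : (iter n2 _ _) => [pc r] [pcP ra].
  have e2' : iter n2 (mstep Pr) (0, upd (fun=> 0) 0 (pickle (F e))) = (pc, r).
    by rewrite -e2; congr iter; congr pair; upd_ext.
  have [n3 e3] := reloc_run A0 (tail o b) e2'.
  have [n4 [r' [r'0 e4]]] := @tail_start A b a r ra.
  exists (n4 + (n3 + n1)), r'; split=> //.
  rewrite iterD iterD e1 catA -/A -/C in e3 *; rewrite e3.
  rewrite (minn_idPr pcP) (_ : size A0 + size Pr = size A) //.
  by rewrite /A size_cat size_map.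
have markedE n : marked e (n + e) <-> (iter n (mstep C) s0).1 = o + 3.
  rewrite /marked irun_core /= nfst_pair -/e -/s0.
  by split=> [/addnI|->].
have unmarked n : n < e -> ~ marked e n.
  by move=> ne; rewrite /marked irun_prelude ?(ltnW ne) //=; lia.
have sparse_e n r : r 0 = 0 -> iter n (mstep C) s0 = (o + 3, r) -> sparse e.
  move=> r0 en B; have [n2 [u [v [Bv e2]]]] := tail_gaps A b r0 B (r 1) (r 2).
  have [m [vm e3 quiet_m]] := tail_cycle A b r0 u v.
  have er : uv r (r 1) (r 2) = r by rewrite /uv; upd_ext.
  (* The last cycle takes [m.+1 > B] steps, so the window of length [B] before its end lies strictly
     inside it. *)
  exists (m.+1 + (n2 + n) + e); split; first by lia.
    by apply/markedE; rewrite iterD iterD en -{1}er e2 e3.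
  move=> k km kB; pose j := k - (n2 + n + e).
  have -> : k = j + (n2 + n) + e by rewrite /j; lia.
  move=> /markedE; rewrite iterD iterD en -{1}er e2; apply: quiet_m.
  by rewrite /j; lia.
have dead_e n r : r 0 = 0 -> iter n (mstep C) s0 = (o + 2, r) -> dead e.
  move=> r0 en k; have [ke|ek] := ltnP k e; first exact: unmarked.
  rewrite -(subnK ek) => /markedE; set j := k - e => ej.
  (* From time [n] on the machine stays at [o + 2]; an earlier visit to [o + 3] would have kept it
     there or beyond. *)
  have [nj|jn] := leqP n j.
    by move: ej; rewrite -(subnK nj) iterD en tail_spin //=; lia.
  have := @tail_closed_iter A b (n - j) (iter j (mstep C) s0).
  by rewrite -iterD subnK ?(ltnW jn) // en ej leqnn /= => /(_ isT); lia.
have [PT PF] := PrP _ (DF e).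
have [h|h] := classic (P (F e)).
  have [n [r [r0]]] := run_ans true (PT h); move: (sparseP e) (deadP e).
  case: (b) => /= sP dP en; first exact: sP (sparse_e _ _ r0 en) h.
  exact: dP (dead_e _ _ r0 en) h.
have [n [r [r0]]] := run_ans false (PF h); move: (sparseP e) (deadP e).
case: (b) => /= sP dP en; first exact: h (dP (dead_e _ _ r0 en)).
exact: h (sP (sparse_e _ _ r0 en)).
Qed.

(** * Languages of dead and sparse machines *)

Section Hits.
Variable e : nat.

Lemma lang_hits u : lang (oca false e) u <-> hits e u.
Proof.
rewrite lang_oca; split=> [[]|] // h; split=> //; case: h => n -> _ //.
  exact: all_word.
exact: sorted_wordE.
Qed.

Lemma hits_word x y : hits e (word x.+1 y) -> x.+1 = y /\ marked e x.
Proof. by case=> n /word_inj[[->] ->] h. Qed.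

Lemma marked_hits n : marked e n -> hits e (word n.+1 n.+1).
Proof. by exists n. Qed.

Lemma dead_hits u : dead e -> ~ hits e u.
Proof. by move=> de [n _ /de]. Qed.

Lemma dead_lang u : dead e -> ~ lang (oca false e) u.
Proof. by move=> de /lang_hits/dead_hits. Qed.

Lemma sparse_lang : sparse e -> exists u, lang (oca false e) u.
Proof.
by move=> /(_ 0)[n [_ /marked_hits h _]]; exists (word n.+1 n.+1); apply/lang_hits.
Qed.

Lemma dead_finite : dead e -> finite_lang (oca false e).
Proof. by move=> de; exists [::] => u /(dead_lang de). Qed.

Lemma sparse_infinite : sparse e -> ~ finite_lang (oca false e).
Proof.
move=> sp [s sP]; have [n [nB /marked_hits/lang_hits/sP us _]] := sp (\max_(u <- s) size u).
have : size (word n.+1 n.+1) <= \max_(u <- s) size u by exact: leq_bigmax_seq.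
by rewrite size_word; lia.
Qed.

Lemma dead_universal : dead e -> universal (oca true e).
Proof.
move=> de u; rewrite lang_oca; split=> [[]|[]] // ? ? ?; split=> //.
exact: dead_hits.
Qed.

Lemma sparse_not_universal : sparse e -> ~ universal (oca true e).
Proof.
move=> /(_ 0)[n [_ /marked_hits h _]] /(_ (word n.+1 n.+1)); rewrite lang_oca.
case=> _ []; last by move=> _ _ _ /(_ h).
by split; [|exact: all_word|exact: sorted_wordE].
Qed.

Lemma dead_regular : dead e -> regular (oca false e).
Proof.
move=> de; exists unit, tt, set0, (fun q _ => q) => w.
by rewrite inE; split=> // /(dead_lang de).
Qed.

(** Pigeonhole on the states reached after the blocks of [a] given by many marked times: merging two
    of them accepts a word with unequal blocks. *)
Lemma sparse_not_regular : sparse e -> ~ regular (oca false e).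
Proof.
move=> sp [Q [q0 [A [d dP]]]].
have many m : exists l : seq nat, [/\ uniq l, size l = m & forall n, n \in l -> marked e n].
  elim: m => [|m [l [ul sl lP]]]; first by exists [::].
  have [n [nB mn _]] := sp (\max_(i <- l) i).+1.
  exists (n :: l); rewrite /= ul sl; split=> //; last first.
    by move=> i; rewrite inE => /predU1P[->|/lP].
  rewrite andbT; apply/negP => nl.
  have : n <= \max_(i <- l) i by exact: leq_bigmax_seq.
  by lia.
have [l [ul sl lP]] := many #|Q|.+1.
pose q n := foldl d q0 (nseq n.+1 (@ord0 1)).
have [/(map_inj_in_uniq)|noinj] := classic {in l &, injective q}.
  rewrite ul => uq; have := max_card (mem (map q l)).
  by rewrite (card_uniqP uq) size_map sl ltnn.
apply: noinj => n n' nl n'l eq_q.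
have wE x y : map val (nseq x (@ord0 1) ++ nseq y (Ordinal (isT : 1 < 2))) = word x y.
  by rewrite map_cat !map_nseq.
have acc : lang (oca false e) (word n'.+1 n'.+1) by apply/lang_hits/marked_hits/lP.
have : lang (oca false e) (word n.+1 n'.+1).
  rewrite -wE; apply/dP; rewrite foldl_cat -/(q n) eq_q /q -foldl_cat.
  by apply/dP; rewrite wE.
by move=> /lang_hits/hits_word[[->]].
Qed.

Lemma dead_context_free : dead e -> context_free (oca false e).
Proof.
move=> de; exists unit, tt, [::] => w; split=> [/(dead_lang de) //|].
have norule (u v : seq (unit + 'I_2)) : derives [::] u v -> u = v.
  by elim=> // u1 v1 w1 [x [y [A [r []]]]].
by move/norule; case: (w).
Qed.

Lemma sparse_not_context_free : sparse e -> ~ context_free (oca false e).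
Proof.
move=> sp [N [S [R gP]]]; have [c [B gap]] := cfg_length_gap R.
(* [n >= c + B] makes the word too long for the first alternative of the gap lemma; the shortened
   word would need a marked time in the window before [n]. *)
have [n [nB mn no]] := sp (c + B).
have [w ew] := val_word_ord (all_word n.+1 n.+1).
have sz (v : seq 'I_2) x y : map val v = word x y -> size v = x + y.
  by rewrite -(size_map val) => ->; rewrite size_word.
have /gP/gap[] : lang (oca false e) (map val w).
  by rewrite ew; apply/lang_hits/marked_hits.
  by rewrite (sz _ _ _ ew) /=; lia.
move=> [w' /gP/lang_hits[m ew' mm]]; rewrite (sz _ _ _ ew) (sz _ _ _ ew') => ?.
by apply: (no m) mm; lia.
Qed.
End Hits.

(** [2 = npair 1 0] codes the empty core program with [q = 1]: after the prelude the machine stays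
    at address 2, short of the marked address 3. *)
Lemma dead2 : dead 2.
Proof.
have f2 : nfst 2 = 1 := nfst_pair 1 0; have n2 : nsnd 2 = 0 := nsnd_pair 1 0.
move=> n; rewrite /marked; suff : pc_at 2 n <= 2 by rewrite f2; lia.
elim: n => // n; rewrite /irun iterS -/(irun 2 n); case: (irun 2 n) => pc r /= pc2.
rewrite /istep /fetch n2; case: ltnP => [lt|_].
  by rewrite (nsnd_pair 0 0 : nsnd 1 = 0).
by have := nnth_leq 0 (pc - 2); rewrite sub0n leqn0 => ->.
Qed.

Theorem all_undecidable (cls : OCA -> Prop) : (forall f e, cls (oca f e)) ->
  all_problems_undecidable cls.
Proof.
move=> clsP.
have D f e : dom cls (oca f e).
  split; [exact: oca_valid|exact: oca_realtime|exact: clsP|exact: oca_bounded].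
have [e0 dead0] : exists e0, dead e0 by exists 2; exact: dead2.
have kE f e : k (oca f e) = 2 by [].
have prF := pr_pickle_oca; pose D2 (p : OCA * OCA) := [/\ dom cls p.1, dom cls p.2 & k p.1 = k p.2].
(* Inclusion in, and equivalence with, a fixed automaton of empty language both amount to
   emptiness. *)
have DF2 e : D2 (oca false e, oca false e0) by split; rewrite /= ?kE.
have prF2 : pr (fun v => pickle (oca false (v 0), oca false e0)).
  apply: (@eq_pr (fun v => npair (pickle (oca false (v 0))) (npair (pickle (oca false e0)) 0))).
    by move=> v; rewrite pickle_pair.
  by apply: pr_npair; [exact: prF|exact: pr_const].
do 6?[split].
- apply: (undecidable_of_family (b := true) (prF false) (D false)) => e.
    exact: dead_finite.
  exact: sparse_infinite.
- apply: (undecidable_of_family (b := false) (prF false) (D false)) => e.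
    by move=> /dead_finite fin; apply.
  exact: sparse_infinite.
- apply: (undecidable_of_family (b := true) (prF true) (D true)) => e.
    exact: dead_universal.
  exact: sparse_not_universal.
- apply: (undecidable_of_family (b := true) prF2 DF2) => e.
    by move=> de u /(dead_lang de).
  by move=> /sparse_lang[u uL] /(_ u uL)/(dead_lang dead0).
- apply: (undecidable_of_family (b := true) prF2 DF2) => e.
    by move=> de u; split=> [/(dead_lang de)|/(dead_lang dead0)].
  by move=> /sparse_lang[u uL] /(_ u)[/(_ uL)/(dead_lang dead0)].
- apply: (undecidable_of_family (b := true) (prF false) (D false)) => e.
    exact: dead_regular.
  exact: sparse_not_regular.
apply: (undecidable_of_family (b := true) (prF false) (D false)) => e.
  exact: dead_context_free.
exact: sparse_not_context_free.
Qed.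

Theorem theorem2 :
  all_problems_undecidable SC_OCA_lin /\ all_problems_undecidable MC_OCA_log.
Proof.
by split; apply: all_undecidable => f e; [exact: oca_SC|exact: oca_MC].
Qed.
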